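(* There is an absolute constant $C>0$ such that the following holds. Let $n\ge 1$ and let $A$ be an $n\times n$ random matrix whose entries $A_{ij}$ are i.i.d. real random variables with $\mathbb{E}A_{ij}=0$ and $\mathbb{E}A_{ij}^2=1$. Let $\varepsilon\in(0,1/6]$. Then, with probability at least $1-7\exp(-\varepsilon n/12)$, there exist sets $I,J\subset[n]$ with $|I|\le\varepsilon n$ and $|J|\le\varepsilon n$ such that the matrix $\tilde A$ obtained from $A$ by replacing every entry $A_{ij}$ with $(i,j)\in I\times J$ by zero satisfies $$\|\tilde A\|\le \frac{C\ln(\varepsilon^{-1})}{\sqrt{\varepsilon}}\sqrt{n}.$$
   Context: $[n]=\{1,\dots,n\}$. $\|\cdot\|$ denotes the operator norm of a matrix as a linear map on $\mathbb{R}^n$ with the Euclidean norm: $\|A\|=\max_{x\neq0}\|Ax\|_2/\|x\|_2$. *)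

(* Defs.v *)
From HB Require Import structures.
From mathcomp Require Import all_boot all_order all_algebra.
From mathcomp Require Import all_classical all_reals all_analysis.

Set Implicit Arguments. Unset Strict Implicit. Unset Printing Implicit Defensive.
Import Order.TTheory GRing.Theory Num.Theory.
Local Open Scope classical_set_scope.
Local Open Scope ring_scope.

Definition eucl_norm (R : realType) (n : nat) (x : 'cV[R]_n) : R :=
  Num.sqrt (\sum_(i < n) x i 0 ^+ 2).

Definition op_norm (R : realType) (n : nat) (A : 'M[R]_n) : R :=
  sup [set eucl_norm (A *m x) / eucl_norm x | x in [set x : 'cV[R]_n | x != 0]].

Definition zero_block (R : realType) (n : nat) (A : 'M[R]_n)
  (I J : {set 'I_n}) : 'M[R]_n :=
  \matrix_(i, j) (if (i \in I) && (j \in J) then 0 else A i j).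

Definition mutually_independent (d : measure_display) (T : measurableType d)
  (R : realType) (P : probability T R) (K : finType) (X : K -> T -> R) : Prop :=
  forall (B : K -> set R), (forall k, measurable (B k)) ->
  forall S : {set K},
    P (\bigcap_(k in [set k | k \in S]) (X k @^-1` B k)) =
    (\prod_(k in S) P (X k @^-1` B k))%E.

Definition identically_distributed (d : measure_display) (T : measurableType d)
  (R : realType) (P : probability T R) (K : Type) (X : K -> T -> R) : Prop :=
  forall k l (B : set R), measurable B -> P (X k @^-1` B) = P (X l @^-1` B).

(* Main.v *)
Require Import Defs.
From HB Require Import structures.
From mathcomp Require Import all_boot all_order all_algebra.
From mathcomp Require Import all_classical all_reals all_analysis.
From mathcomp Require Import measurable_realfun ring lra.

Set Implicit Arguments. Unset Strict Implicit. Unset Printing Implicit Defensive.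
Import Order.TTheory GRing.Theory Num.Theory.
Local Open Scope classical_set_scope.
Local Open Scope ring_scope.

(** It suffices to remove at most eps * n columns so that the rest of the matrix
    has norm O (ln (1/eps) * sqrt (n / eps)): applying this to A and to its
    transpose gives J and I, and the modified matrix is the sum of A off the
    columns J and of the part of A in the columns J off the rows I.

    Put L = 69 + ln (1/eps). With high probability few columns have to be removed
    so that every row satisfies sum_j min (A_ij ^ 2, n) <= L n, every column meets
    at most L entries with A_ij ^ 2 > n, and no entry has A_ij ^ 2 > 48 n / eps.
    The remaining entries with A_ij ^ 2 > n form a matrix with at most L nonzero
    entries per row and column, of norm at most L * sqrt (48 n / eps).

    For the part B of entries with A_ij ^ 2 <= n, the inequality
    exp (y - y^2/2) <= 1 + y + y^2/2 bounds the expectation of self-normalized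
    exponential sums; a union bound over x in {-1, 0, 1}^n gives
    |B x|^2 <= 144 L n^2 whenever x is supported on the kept columns, so B is
    bounded from l^infty to l^2. The little Grothendieck inequality and a greedy
    removal of eps * n / 4 further columns turn this into an l^2 bound. *)

(** * Squared norms and sums over signs *)

Definition sqnorm (R : realType) (I : finType) (x : I -> R) : R :=
  \sum_i x i ^+ 2.

Definition matvec (R : realType) (H I : finType) (A : H -> I -> R) (x : I -> R) :
  H -> R := fun i => \sum_j A i j * x j.

(* All [2 ^ size xs] sums [\sum_x +/- x]: summing over this list plays the role of
   the expectation over independent Rademacher signs. *)
Fixpoint signsums (R : realType) (I : Type) (xs : seq (I -> R)) : seq (I -> R) :=
  if xs is x :: xs' then
    [seq y \+ x | y <- signsums xs'] ++ [seq y \- x | y <- signsums xs']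
  else [:: fun=> 0].

Lemma sqnorm_ge0 (R : realType) (I : finType) (x : I -> R) : 0 <= sqnorm x.
Proof. by apply: sumr_ge0 => i _; apply: sqr_ge0. Qed.

Lemma sqnorm_coord (R : realType) (I : finType) (x : I -> R) j : x j ^+ 2 <= sqnorm x.
Proof. by rewrite /sqnorm (bigD1 j)//= lerDl sumr_ge0// => i _; apply: sqr_ge0. Qed.

Lemma sqnormZ (R : realType) (I : finType) (c : R) (x : I -> R) :
  sqnorm (fun i => c * x i) = c ^+ 2 * sqnorm x.
Proof. by rewrite /sqnorm big_distrr; apply: eq_bigr => i _; rewrite exprMn. Qed.

Lemma matvecD (R : realType) (H I : finType) (A : H -> I -> R) x y i :
  matvec A (x \+ y) i = matvec A x i + matvec A y i.
Proof. by rewrite /matvec -big_split; apply: eq_bigr => j _; rewrite /= mulrDr. Qed.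

Lemma matvecB (R : realType) (H I : finType) (A : H -> I -> R) x y i :
  matvec A (x \- y) i = matvec A x i - matvec A y i.
Proof. by rewrite /matvec -sumrB; apply: eq_bigr => j _; rewrite /= mulrBr. Qed.

Lemma matvecZ (R : realType) (H I : finType) (A : H -> I -> R) (c : R) x i :
  matvec A (fun j => c * x j) i = c * matvec A x i.
Proof. by rewrite /matvec big_distrr; apply: eq_bigr => j _; rewrite /= mulrCA. Qed.

Lemma sqnorm_matvecZ (R : realType) (H I : finType) (A : H -> I -> R) (c : R) x :
  sqnorm (matvec A (fun j => c * x j)) = c ^+ 2 * sqnorm (matvec A x).
Proof. by rewrite -sqnormZ; apply: eq_bigr => i _; rewrite matvecZ. Qed.

Lemma sqnormD_le (R : realType) (I : finType) (x y : I -> R) :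
  sqnorm (fun i => x i + y i) <= 2 * sqnorm x + 2 * sqnorm y.
Proof.
rewrite /sqnorm !big_distrr -big_split; apply: ler_sum => i _ /=.
by have := sqr_ge0 (x i - y i); nra.
Qed.

Lemma cauchy_schwarz_sum (R : realType) (I : finType) (x y : I -> R) :
  (\sum_i x i * y i) ^+ 2 <= sqnorm x * sqnorm y.
Proof.
set s := \sum_i x i * y i.
have Hp : 0 <= \sum_i (sqnorm y * x i - s * y i) ^+ 2.
  by apply: sumr_ge0 => i _; apply: sqr_ge0.
have F a b : \sum_i (a * x i - b * y i) ^+ 2 =
    a ^+ 2 * sqnorm x - 2 * a * b * s + b ^+ 2 * sqnorm y.
  rewrite /sqnorm /s !big_distrr -sumrB -big_split /=.
  by apply: eq_bigr => i _; ring.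
have E : \sum_i (sqnorm y * x i - s * y i) ^+ 2 = sqnorm y * (sqnorm x * sqnorm y - s ^+ 2).
  by rewrite F; ring.
rewrite E in Hp.
have [y0|y0] := eqVneq (sqnorm y) 0.
  have yi i : y i = 0.
    by apply/eqP; rewrite -sqrf_eq0 eq_le sqr_ge0 andbT -y0 sqnorm_coord.
  by rewrite /s big1 ?expr0n ?mulr_ge0 ?sqnorm_ge0// => i _; rewrite yi mulr0.
by move: Hp; rewrite pmulr_rge0 ?subr_ge0// lt_neqAle eq_sym y0 sqnorm_ge0.
Qed.

Lemma size_signsums (R : realType) (I : Type) (xs : seq (I -> R)) :
  size (signsums xs) = (2 ^ size xs)%N.
Proof. by elim: xs => //= x xs IH; rewrite size_cat !size_map IH addnn -mul2n -expnS. Qed.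

Section additive_functional.
Context (R : realType) (I : Type) (l : (I -> R) -> R).
Hypothesis l0 : l (fun=> 0) = 0.
Hypothesis lD : forall x y, l (x \+ y) = l x + l y.
Hypothesis lB : forall x y, l (x \- y) = l x - l y.

Lemma signsums_cons (f : R -> R) x xs :
  \sum_(y <- signsums (x :: xs)) f (l y) =
  \sum_(y <- signsums xs) (f (l y + l x) + f (l y - l x)).
Proof.
rewrite /= big_cat !big_map big_split /=.
by congr (_ + _); apply: eq_bigr => y _; rewrite (lD, lB).
Qed.

Lemma signsums_sqr xs :
  \sum_(y <- signsums xs) l y ^+ 2 = 2 ^+ size xs * \sum_(x <- xs) l x ^+ 2.
Proof.
elim: xs => [|x xs IH].
  by rewrite /= big_nil big_seq1 l0 expr0n mulr0.
rewrite (signsums_cons (fun z => z ^+ 2)) big_cons /= exprS mulrDr -mulrA -mulrA -IH.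
rewrite [X in _ = _ * X + _](_ : _ = \sum_(y <- signsums xs) l x ^+ 2); last first.
  by rewrite big_const_seq count_predT size_signsums iter_addr_0 -[in RHS]mulr_natl natrX.
rewrite !big_distrr -big_split /=.
by apply: eq_bigr => y _; ring.
Qed.

(** Khintchine's inequality for fourth moments. A further summand [u] adds [6 u^2 s + u^4] to the
    average fourth power, where [s] is the second moment, and [3 (s + u^2)^2] exceeds [3 s^2] by at
    least that. *)
Lemma signsums_quartic xs :
  \sum_(y <- signsums xs) l y ^+ 4 <=
  3 * 2 ^+ size xs * (\sum_(x <- xs) l x ^+ 2) ^+ 2.
Proof.
elim: xs => [|x xs IH].
  by rewrite /= big_nil big_seq1 l0 !expr0n /= mulr0.
rewrite (signsums_cons (fun z => z ^+ 4)) big_cons /= exprS.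
have -> : \sum_(y <- signsums xs) ((l y + l x) ^+ 4 + (l y - l x) ^+ 4) =
   2 * \sum_(y <- signsums xs) l y ^+ 4 +
   12 * l x ^+ 2 * \sum_(y <- signsums xs) l y ^+ 2 +
   2 * l x ^+ 4 * \sum_(y <- signsums xs) 1.
  by rewrite !big_distrr -!big_split /=; apply: eq_bigr => y _; ring.
rewrite signsums_sqr [\sum_(y <- _) 1]big_const_seq count_predT size_signsums.
rewrite iter_addr_0 natrX.
move: IH; set S := \sum_(y <- _) l y ^+ 4; set s := \sum_(x0 <- xs) _.
set P := 2 ^+ size xs; set u := l x => IH.
have P0 : 0 <= P by rewrite exprn_ge0.
have : 0 <= P * u ^+ 4 by rewrite mulr_ge0// exprn_even_ge0.
nra.
Qed.

End additive_functional.

Lemma signsums_matvec (R : realType) (H I : finType) (A : H -> I -> R) xs :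
  \sum_(y <- signsums xs) sqnorm (matvec A y) = 2 ^+ size xs * \sum_(x <- xs) sqnorm (matvec A x).
Proof.
rewrite /sqnorm exchange_big [in RHS]exchange_big big_distrr; apply: eq_bigr => i _ /=.
rewrite (@signsums_sqr R I (fun x => matvec A x i))//.
- by rewrite /matvec big1// => j _; rewrite mulr0.
- by move=> x y; rewrite matvecD.
- by move=> x y; rewrite matvecB.
Qed.

(** * The little Grothendieck inequality and column selection *)

Definition clip (R : realType) (t : R) : R :=
  if 1 <= t then 1 else if t <= -1 then -1 else t.

Lemma norm_clip (R : realType) (t : R) : `|clip t| <= 1.
Proof.
rewrite /clip ler_norml; apply/andP.
by case: (leP 1 t) => h; [|case: (leP t (-1)) => h']; split; lra.
Qed.

(** Outside the cube this is [4 (|t| - 1) <= t^2], a perfect square. With fourth moments at most 3,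
    the factor 16 makes the second moment of the remainder at most 3/16. *)
Lemma clip_remainder (R : realType) (t : R) : 16 * (t - clip t) ^+ 2 <= t ^+ 4.
Proof.
rewrite /clip; case: (leP 1 t) => h; [|case: (leP t (-1)) => h'].
- have e : t ^+ 4 - 16 * (t - 1) ^+ 2 = (t - 2) ^+ 2 * (t ^+ 2 + 4 * t - 4) by ring.
  by rewrite -subr_ge0 e mulr_ge0 ?sqr_ge0//; nra.
- have e : t ^+ 4 - 16 * (t - -1) ^+ 2 = (t + 2) ^+ 2 * (t ^+ 2 - 4 * t - 4) by ring.
  by rewrite -subr_ge0 e mulr_ge0 ?sqr_ge0//; nra.
- by rewrite subrr expr0n mulr0 exprn_even_ge0.
Qed.

(* The best constant [G] for families bootstraps: a random sign combination of
   the family splits into a part in the cube and a remainder whose coordinates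
   have second moment at most 1/4, whence [G <= 2 M + G / 2]. *)
Lemma little_grothendieck (R : realType) (H I : finType) (A : H -> I -> R) (M : R) :
  (forall x, (forall j, `|x j| <= 1) -> sqnorm (matvec A x) <= M) ->
  forall xs : seq (I -> R), (forall j, \sum_(x <- xs) x j ^+ 2 <= 1) ->
  \sum_(x <- xs) sqnorm (matvec A x) <= 4 * M.
Proof.
move=> hM.
pose fam (xs : seq (I -> R)) := forall j, \sum_(x <- xs) x j ^+ 2 <= 1.
pose val (xs : seq (I -> R)) := \sum_(x <- xs) sqnorm (matvec A x).
pose S := [set val xs | xs in [set xs | fam xs]].
pose A2 := \sum_i \sum_j A i j ^+ 2.
have A2ge0 : 0 <= A2 by do 2!(apply: sumr_ge0 => ? _); apply: sqr_ge0.
(* A crude bound that makes the supremum finite, without which [G <= 2 M + G / 2] would say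
   nothing. *)
have crude xs : fam xs -> val xs <= A2 * #|I|%:R.
  move=> fx; apply: (@le_trans _ _ (\sum_(x <- xs) A2 * sqnorm x)).
    apply: ler_sum => x _; rewrite {1}/sqnorm /A2 big_distrl; apply: ler_sum => i _.
    exact: cauchy_schwarz_sum.
  rewrite -big_distrr ler_wpM2l//= exchange_big /=.
  by rewrite -sum1_card natr_sum; apply: ler_sum => j _.
have S0 : S !=set0 by exists (val [::]), [::] => // j; rewrite big_nil.
have ubS : has_ubound S by exists (A2 * #|I|%:R) => _ [xs fx <-]; exact: crude.
have supP xs : fam xs -> val xs <= sup S.
  by move=> fx; apply: ub_le_sup => //; exists xs.
have boot xs : fam xs -> val xs <= 2 * M + sup S / 2.
  move=> fx.
  pose P : R := 2 ^+ size xs; have P0 : 0 < P by rewrite exprn_gt0.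
  pose r (y : I -> R) j := y j - clip (y j).
  (* [1 / sqrt P] turns the sum over the [P] sign choices into an average; second moments below 1/4
     leave room for the factor 2. *)
  pose c := 2 / Num.sqrt P.
  have c2 : c ^+ 2 = 4 / P by rewrite expr_div_n sqr_sqrtr ?ltW// -natrX.
  pose zs := [seq (fun j => c * r y j) | y <- signsums xs].
  have fz : fam zs.
    move=> j; rewrite big_map.
    have -> : \sum_(y <- signsums xs) (c * r y j) ^+ 2 =
              (4 * P)^-1 * \sum_(y <- signsums xs) 16 * (y j - clip (y j)) ^+ 2.
      rewrite big_distrr; apply: eq_bigr => y _; rewrite exprMn c2 /r /=.
      by field; rewrite gt_eqF.
    rewrite mulrC ler_pdivrMr ?mulr_gt0// mul1r.
    apply: (@le_trans _ _ (\sum_(y <- signsums xs) y j ^+ 4)).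
      by apply: ler_sum => y _; exact: clip_remainder.
    apply: (le_trans (@signsums_quartic R I (fun x => x j) erefl
      (fun _ _ => erefl) (fun _ _ => erefl) xs)).
    have /= := fx j; set s := \sum_(x <- xs) _ => s1.
    have s0 : 0 <= s by apply: sumr_ge0 => ? _; apply: sqr_ge0.
    have s2 : s ^+ 2 <= 1 by nra.
    rewrite -/P -mulrA mulrCA [leRHS]mulrC ler_pM2l//; lra.
  have vz : val zs = 4 / P * \sum_(y <- signsums xs) sqnorm (matvec A (r y)).
    by rewrite /val big_map big_distrr; apply: eq_bigr => y _; rewrite sqnorm_matvecZ c2.
  have e : P * val xs = \sum_(y <- signsums xs) sqnorm (matvec A y) by rewrite signsums_matvec.
  have split : P * val xs <= 2 * (P * M) + 2 * \sum_(y <- signsums xs) sqnorm (matvec A (r y)).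
    rewrite e.
    have -> : P * M = \sum_(y <- signsums xs) M.
      by rewrite big_const_seq count_predT size_signsums iter_addr_0 -mulr_natl natrX.
    rewrite !big_distrr -big_split /=; apply: ler_sum => y _.
    have -> : sqnorm (matvec A y) =
      sqnorm (fun i => matvec A (fun j => clip (y j)) i + matvec A (r y) i).
      apply: eq_bigr => i _; rewrite -matvecD; congr (_ ^+ 2).
      by apply: eq_bigr => j _; rewrite /r /=; ring.
    apply: (le_trans (sqnormD_le _ _)); rewrite lerD2r ler_pM2l//.
    by apply: hM => j; exact: norm_clip.
  have vzS := supP _ fz; rewrite vz in vzS.
  have : P * val xs <= P * (2 * M + sup S / 2).
    apply: (le_trans split).
    move: vzS; set q := \sum_(y <- _) _ => vzS.
    have : q <= P / 4 * sup S.
      move: vzS; rewrite -ler_pdivlMl ?divr_gt0//.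
      by rewrite invf_div.
    lra.
  by rewrite ler_pM2l.
have : sup S <= 2 * M + sup S / 2 by apply: ge_sup => // _ [xs fx <-]; exact: boot.
move=> h xs fx; have := supP _ fx; rewrite /val; lra.
Qed.

Lemma card_le_sum_sqnorm (R : realType) (I : finType) (xs : seq (I -> R)) (J : {set I}) :
  (forall j, j \in J -> 1 <= \sum_(x <- xs) x j ^+ 2) ->
  #|J|%:R <= \sum_(x <- xs) sqnorm x.
Proof.
move=> h; rewrite /sqnorm exchange_big /= -sum1_card natr_sum.
apply: (@le_trans _ _ (\sum_(j in J) \sum_(x <- xs) x j ^+ 2)).
  by apply: ler_sum => j; exact: h.
rewrite [leRHS](bigID (mem J)) lerDl /=; apply: sumr_ge0 => j _.
by apply: sumr_ge0 => x _; apply: sqr_ge0.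
Qed.

(* Column selection without duality: while the norm off the columns of weight
   at least 1 stays large, append a near-extremal unit vector supported on the
   other columns; after [N] steps this contradicts the little Grothendieck
   inequality. *)
Lemma column_selection (R : realType) (H I : finType) (A : H -> I -> R) (M : R) (N : nat) :
  (forall x, (forall j, `|x j| <= 1) -> sqnorm (matvec A x) <= M) ->
  exists2 J : {set I}, (#|J| <= N)%N &
    forall x, (forall j, j \in J -> x j = 0) -> sqnorm (matvec A x) * N%:R <= 8 * M * sqnorm x.
Proof.
move=> hM.
have M0 : 0 <= M.
  apply: le_trans (hM (fun=> 0) _); first exact: sqnorm_ge0.
  by move=> j; rewrite normr0.
case: N => [|N].
  by exists finset.set0 => [|x _]; rewrite ?cards0// mulr0 !mulr_ge0 ?sqnorm_ge0.
apply/not_exists2P => hno.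
have step (J : {set I}) : (#|J| <= N.+1)%N -> exists x : I -> R,
    [/\ forall j, j \in J -> x j = 0, sqnorm x = 1 & 8 * M < sqnorm (matvec A x) * N.+1%:R].
  move=> cJ; have [//|/existsNP[x /not_implyP[xJ /negP]]] := hno J.
  rewrite -ltNge => hx.
  have x0 : 0 < sqnorm x.
    rewrite lt_neqAle sqnorm_ge0 andbT eq_sym; apply/negP => /eqP x0.
    have xj j : x j = 0.
      by apply/eqP; rewrite -sqrf_eq0 eq_le sqr_ge0 andbT -x0 sqnorm_coord.
    move: hx; rewrite x0 mulr0 /sqnorm big1 ?mul0r ?ltxx// => i _.
    by rewrite /matvec big1 ?expr0n// => j _; rewrite xj mulr0.
  pose c := (Num.sqrt (sqnorm x))^-1.
  have c2 : c ^+ 2 = (sqnorm x)^-1 by rewrite exprVn sqr_sqrtr// ltW.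
  exists (fun j => c * x j); split.
  - by move=> j jJ; rewrite xJ// mulr0.
  - by rewrite sqnormZ c2 mulVf ?gt_eqF.
  - by rewrite sqnorm_matvecZ c2 -mulrA ltr_pdivlMl// mulrC.
have build t : (t <= N.+1)%N -> exists xs : seq (I -> R),
    [/\ size xs = t, \sum_(x <- xs) sqnorm x = t%:R,
        forall j, \sum_(x <- xs) x j ^+ 2 <= 2,
        8 * M * t%:R <= \sum_(x <- xs) sqnorm (matvec A x) * N.+1%:R &
        (0 < t)%N -> 8 * M * t%:R < \sum_(x <- xs) sqnorm (matvec A x) * N.+1%:R].
  elim: t => [_|t IH tN].
    by exists [::]; split => // [|j|]; rewrite !big_nil// mulr0.
  have [xs [sz s1 s2 s3 _]] := IH (ltnW tN).
  pose J := [set j | 1 <= \sum_(x <- xs) x j ^+ 2]%SET.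
  (* The total weight is [t], and each column of [J] has weight at least 1. *)
  have cJ : (#|J| <= N.+1)%N.
    apply: leq_trans (ltnW tN); rewrite -(ler_nat R) -s1.
    by apply: card_le_sum_sqnorm => j; rewrite inE.
  have [x [xJ x1 x2]] := step J cJ.
  exists (x :: xs); split => [||j||_].
  - by rewrite /= sz.
  - by rewrite big_cons s1 x1 nat1r.
  (* On [J] the new unit vector vanishes; elsewhere a weight below 1 grows by at most 1. So no
     weight exceeds 2. *)
  - rewrite big_cons; have [jJ|] := boolP (j \in J).
      by rewrite xJ// expr0n add0r.
    rewrite inE -ltNge => /ltW h; have := sqnorm_coord x j; rewrite x1 => h'; lra.
  - by rewrite big_cons -natr1; lra.
  - by rewrite big_cons -natr1; lra.
have [xs [_ _ s2 _ /(_ isT) s3]] := build N.+1 (leqnn _).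
(* Division by [sqrt 2] brings the weights down to 1; the inequality then reads [q / 2 <= 4 M],
   against [q > 8 M]. *)
have : \sum_(x <- [seq (fun j => (Num.sqrt 2)^-1 * x j) | x <- xs]) sqnorm (matvec A x) <= 4 * M.
  apply: little_grothendieck hM _ _ => j; rewrite big_map.
  under eq_bigr do rewrite exprMn exprVn sqr_sqrtr//.
  by rewrite -big_distrr /= mulrC ler_pdivrMr// mul1r.
rewrite big_map; under eq_bigr do rewrite sqnorm_matvecZ exprVn sqr_sqrtr//.
rewrite -big_distrr /=.
move: s3; rewrite -big_distrl /=; set q := \sum_(x <- xs) _ => /=.
rewrite ltr_pM2r ?ltr0n//; lra.
Qed.

(** Along each coordinate the squared norm is a convex quadratic polynomial, hence largest at an
    endpoint. Coordinates are moved to endpoints one at a time; the list [s] holds those still to be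
    moved. *)
Lemma sqnorm_matvec_cube (R : realType) (H I : finType) (A : H -> I -> R) (M : R) :
  (forall x, (forall j, x j = 1 \/ x j = -1) -> sqnorm (matvec A x) <= M) ->
  forall x, (forall j, `|x j| <= 1) -> sqnorm (matvec A x) <= M.
Proof.
move=> hM.
suff E (s : seq I) x : (forall j, `|x j| <= 1) ->
    (forall j, j \notin s -> x j = 1 \/ x j = -1) -> sqnorm (matvec A x) <= M.
  by move=> x hx; apply: (E (enum I)) => // j; rewrite mem_enum.
elim: s x => [|j s IH] x x1 xs; first by apply: hM => j; exact: xs.
pose u t i := if i == j then t else x i.
have bu t : `|t| = 1 -> sqnorm (matvec A (u t)) <= M.
  move=> t1; apply: IH => i.
    by rewrite /u; case: eqP => // _; rewrite t1.
  move=> ins; rewrite /u; case: eqP => [ij|/eqP ij]; last first.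
    by apply: xs; rewrite inE negb_or ij.
  by move/eqP: t1; rewrite eqr_norml => /andP[/orP[]/eqP-> _]; [left|right].
pose a := sqnorm (matvec A (u 0)).
pose b := \sum_i matvec A (u 0) i * A i j.
pose c := \sum_i A i j ^+ 2.
have quad t : sqnorm (matvec A (u t)) = a + 2 * t * b + t ^+ 2 * c.
  rewrite /a /b /c /sqnorm !big_distrr -!big_split /=; apply: eq_bigr => i _.
  have -> : matvec A (u t) i = matvec A (u 0) i + t * A i j.
    rewrite /matvec (bigD1 j)//= [in RHS](bigD1 j)//= /u eqxx mulr0 add0r addrC.
    rewrite [A i j * t]mulrC; congr (_ + _).
    by apply: eq_bigr => k /negPf ->.
  by ring.
have c0 : 0 <= c by apply: sumr_ge0 => i _; apply: sqr_ge0.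
have -> : sqnorm (matvec A x) = sqnorm (matvec A (u (x j))).
  apply: eq_bigr => i _; congr (_ ^+ 2); apply: eq_bigr => k _.
  by rewrite /u; case: eqP => // ->.
have := bu 1 (normr1 _); have := bu (-1) (normrN1 _); rewrite !quad.
have := x1 j; rewrite ler_norml; set t := x j => /andP[t1 t2] h1 h2.
have : t ^+ 2 * c <= c by rewrite ler_piMl//; nra.
nra.
Qed.

(** * Truncation and sparse matrices *)

Definition trunc2 (R : realType) (T a : R) : R := if a ^+ 2 <= T then a else 0.

Lemma trunc2_sqr (R : realType) (T a : R) : 0 <= T -> trunc2 T a ^+ 2 <= Num.min (a ^+ 2) T.
Proof.
rewrite /trunc2 => T0; rewrite le_min; case: ifP => h; first by rewrite lexx.
by rewrite expr0n sqr_ge0.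
Qed.

(** Schur's test: Cauchy-Schwarz in a row costs the number of its marked entries, and exchanging the
    sums counts each coordinate of [x] once per marked entry of its column. *)
Lemma sparse_bound (R : realType) (H I : finType) (A : H -> I -> R)
    (S : H -> I -> bool) (r c T : R) :
  0 <= r -> 0 <= T ->
  (forall i, \sum_j (S i j)%:R <= r) -> (forall j, \sum_i (S i j)%:R <= c) ->
  (forall i j, A i j ^+ 2 <= T * (S i j)%:R) ->
  forall x, sqnorm (matvec A x) <= r * c * T * sqnorm x.
Proof.
move=> r0 T0 hr hc hA x.
have row i : matvec A x i ^+ 2 <= r * \sum_j (T * (S i j)%:R * x j ^+ 2).
  have -> : matvec A x i = \sum_j (S i j)%:R * (A i j * x j).
    apply: eq_bigr => j _; have := hA i j; case: (S i j); rewrite ?mul1r// mulr0.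
    by move=> h; have /eqP := le_anti (introT andP (conj h (sqr_ge0 _)));
      rewrite sqrf_eq0 => /eqP ->; rewrite !mul0r.
  apply: (le_trans (cauchy_schwarz_sum _ _)); apply: ler_pM; rewrite ?sqnorm_ge0//.
    apply: le_trans (hr i); rewrite /sqnorm; apply: ler_sum => j _.
    by case: (S i j); rewrite ?expr1n ?expr0n.
  by apply: ler_sum => j _; rewrite exprMn ler_wpM2r ?sqr_ge0.
apply: (@le_trans _ _ (\sum_i r * \sum_j (T * (S i j)%:R * x j ^+ 2))).
  by apply: ler_sum => i _; exact: row.
rewrite -big_distrr /= -!mulrA ler_wpM2l// exchange_big /= mulrA big_distrr /=.
apply: ler_sum => j _; rewrite -big_distrl /= ler_wpM2r ?sqr_ge0//.
by rewrite -big_distrr /= mulrC ler_wpM2r.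
Qed.

(** * Row truncation by removal of columns *)

(* If [F_k := \sum_j min (v_j ^ 2, y_k) / y_k] with [y_k := n / 2 ^ k] exceeds
   [L * 2 ^ k], then [3 * F_k - L * 2 ^ k >= 2 * F_k >= F_(k+1)], and [F_(k+1)]
   bounds the number of entries with [v_j ^ 2 > y_(k+1)]. So [rowW v] dominates
   the exponential of the number of entries to be removed from the row [v],
   while its expectation is controlled by the second moment alone. The index
   [None] carries the summand [1]. *)
Section row_selection.
Context (R : realType) (n : nat) (L : R).

Definition level (k : nat) : R := n%:R / 2 ^+ k.

Definition rowterm (m : option 'I_n) (a : R) : R :=
  if m is Some k then expR (3 * (Num.min (a ^+ 2) (level k) / level k)) else 1.

Definition rowweight (m : option 'I_n) : R :=
  if m is Some k then expR (- (L * 2 ^+ k)) else 1.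

Definition rowW (v : 'I_n -> R) : R :=
  \sum_(m : option 'I_n) rowweight m * \prod_j rowterm m (v j).

Lemma level_gt0 k : (0 < n)%N -> 0 < level k.
Proof. by move=> n0; rewrite divr_gt0 ?ltr0n// exprn_gt0. Qed.

Definition rowF (v : 'I_n -> R) (k : nat) : R :=
  \sum_j Num.min (v j ^+ 2) (level k) / level k.

Lemma prod_rowterm (v : 'I_n -> R) (k : 'I_n) :
  rowweight (Some k) * \prod_j rowterm (Some k) (v j) =
  expR (3 * rowF v k - L * 2 ^+ k).
Proof. by rewrite /= -expR_sum -expRD addrC -big_distrr. Qed.

Lemma rowW_ge (v : 'I_n -> R) (m : option 'I_n) : rowweight m * \prod_j rowterm m (v j) <= rowW v.
Proof.
rewrite /rowW (bigD1 m)//= lerDl sumr_ge0// => m' _; rewrite mulr_ge0//.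
  by case: m' => [k|] //=; exact: expR_ge0.
by apply: prodr_ge0 => j _; case: m' => [k|] //=; exact: expR_ge0.
Qed.

Lemma rowW_ge1 (v : 'I_n -> R) : 1 <= rowW v.
Proof. by apply: le_trans (rowW_ge v None); rewrite /= big1 ?mulr1. Qed.

Hypothesis L_ge1 : 1 <= L.

(** Meant for heavy columns, which are removed whole at the price of one factor [exp 1]; level 0
    alone contributes [exp (3 F_0 - L)] with [F_0 > L]. *)
Lemma rowW_bad (v : 'I_n -> R) : (0 < n)%N -> L * n%:R < \sum_j Num.min (v j ^+ 2) n%:R -> expR 1 <= rowW v.
Proof.
move=> n0 h.
apply: le_trans (rowW_ge v (Some (Ordinal n0))); rewrite prod_rowterm ler_expR /=.
rewrite /rowF /level expr0 divr1 -big_distrl /= mulr1.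
have {h} : L < (\sum_j Num.min (v j ^+ 2) n%:R) / n%:R by rewrite ltr_pdivlMr ?ltr0n.
have h1 := L_ge1; move: (_ / _) => q hq; lra.
Qed.

Lemma row_selection (v : 'I_n -> R) : (0 < n)%N -> exists2 D : {set 'I_n},
  expR #|D|%:R <= rowW v & \sum_(j | j \notin D) Num.min (v j ^+ 2) n%:R <= L * n%:R.
Proof.
move=> n0.
(* Each term of [F_k] is at most 1, so [F_k <= n < 2 ^ n] and level [n] qualifies at the latest; the
   least such level is taken. *)
have ex : exists k, rowF v k <= L * 2 ^+ k.
  exists n; apply: (@le_trans _ _ (n%:R)).
    rewrite -[X in _ <= X%:R](card_ord n) -sum1_card natr_sum; apply: ler_sum => j _.
    by rewrite ler_pdivrMr ?level_gt0// mul1r ge_min lexx orbT.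
  apply: (@le_trans _ _ (1 * 2 ^+ n)); last by rewrite ler_wpM2r// exprn_ge0.
  by rewrite mul1r -natrX ler_nat ltnW// ltn_expl.
case: (ex_minnP ex) => -[|k] hk kmin.
  exists finset.set0; first by rewrite cards0 expR0 rowW_ge1.
  move: hk; rewrite /rowF /level expr0 divr1 mulr1 -big_distrl /= ler_pdivrMr ?ltr0n//.
  by apply: le_trans; rewrite big_mkcond; apply: ler_sum => j _; rewrite inE.
have hk' : L * 2 ^+ k < rowF v k.
  by rewrite ltNge; apply/negP => h; have := kmin _ h; rewrite ltnn.
have kn : (k < n)%N.
  rewrite ltnNge; apply/negP => nk; suff : rowF v k <= L * 2 ^+ k by rewrite leNgt hk'.
  apply: (@le_trans _ _ (n%:R)).
    rewrite -[X in _ <= X%:R](card_ord n) -sum1_card natr_sum; apply: ler_sum => j _.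
    by rewrite ler_pdivrMr ?level_gt0// mul1r ge_min lexx orbT.
  apply: (@le_trans _ _ (1 * 2 ^+ k)); last by rewrite ler_wpM2r// exprn_ge0.
  by rewrite mul1r -natrX ler_nat (leq_trans nk)// ltnW// ltn_expl.
have lk : level k.+1 = level k / 2 by rewrite /level exprS; field; rewrite expf_neq0.
have l0 := level_gt0 k n0.
have l0' := level_gt0 k.+1 n0.
(* An entry above half of level [k] contributes at least 1/2 to [F_k], so there are at most [2 F_k]
   of them. *)
pose D := [set j | level k.+1 < v j ^+ 2]%SET.
have cD : #|D|%:R <= 2 * rowF v k.
  rewrite -sum1_card natr_sum big_mkcond /rowF big_distrr; apply: ler_sum => j _ /=.
  rewrite mulrA ler_pdivlMr// inE; case: ifP => h.
    by rewrite mul1r; move: h; rewrite lk; case: (leP (v j ^+ 2) (level k)) => h' h; lra.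
  by rewrite mul0r mulr_ge0// le_min sqr_ge0 ltW.
exists D.
  apply: le_trans (rowW_ge v (Some (Ordinal kn))); rewrite prod_rowterm /= ler_expR.
  lra.
(* The kept entries do not exceed level [k + 1], so the truncation there leaves them unchanged. *)
apply: (@le_trans _ _ (level k.+1 * rowF v k.+1)).
  rewrite /rowF big_distrr big_mkcond; apply: ler_sum => j _ /=.
  rewrite mulrC divfK ?gt_eqF// inE -leNgt; case: ifP => h.
    have -> : Num.min (v j ^+ 2) (level k.+1) = v j ^+ 2 by apply/min_idPl.
    by rewrite ge_min lexx.
  by rewrite le_min sqr_ge0 ltW.
apply: (le_trans (ler_wpM2l (ltW l0') hk)); rewrite /level.
by rewrite mulrC -mulrA mulrC [2 ^+ _ * _]mulrC divfK ?expf_neq0// mulrC.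
Qed.

End row_selection.

(** * The self-normalized sign net *)

(* [netrow] is a discretized Gaussian mixture of the self-normalized exponentials
   [exp (t * xi - t ^ 2 * V / 2)], [xi] the inner product of the row with the sign
   vector and [V] its quadratic variation; as soon as [V <= L * n] it is at least
   [exp (c * xi ^ 2 / (L * n) - C)]. Vectors in {-1, 0, 1}^n are needed because
   the set of removed columns is random. *)
Section sign_net.
Context (R : realType) (n : nat) (lam : R).

Definition sign3 (o : option bool) : R :=
  if o is Some b then (if b then 1 else -1) else 0.

Definition netweight (m : 'I_n.+1 * bool) : R :=
  expR (- (m.1%:R + m.1%:R ^+ 2)).

Definition slope (m : 'I_n.+1 * bool) : R := (if m.2 then 1 else -1) * m.1%:R * lam.

Definition netterm (o : option bool) (m : 'I_n.+1 * bool) (a : R) : R :=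
  let y := slope m * sign3 o * trunc2 n%:R a in expR (y - y ^+ 2 / 2).

Definition netrow (x : 'I_n -> option bool) (v : 'I_n -> R) : R :=
  \sum_m netweight m * \prod_j netterm (x j) m (v j).

Definition netV (A : 'I_n -> 'I_n -> R) : R :=
  \sum_(x : {ffun 'I_n -> option bool}) \prod_i netrow x (A i).

Lemma netrow_ge (x : 'I_n -> option bool) (v : 'I_n -> R) m :
  netweight m * \prod_j netterm (x j) m (v j) <= netrow x v.
Proof.
rewrite /netrow (bigD1 m)//= lerDl sumr_ge0// => m' _.
by rewrite mulr_ge0 ?expR_ge0// prodr_ge0// => j _; exact: expR_ge0.
Qed.

Lemma netrow_ge0 (x : 'I_n -> option bool) (v : 'I_n -> R) : 0 <= netrow x v.
Proof.
apply: le_trans (netrow_ge _ _ (ord0, true)).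
by rewrite mulr_ge0 ?expR_ge0// prodr_ge0// => j _; exact: expR_ge0.
Qed.

(** The parabola [k h - 3 k^2 / 2] peaks at [k = h / 3] with value [h^2 / 6]; rounding down and the
    linear term are paid for by the smaller constant 1/18 and the summand 2. *)
Lemma quadratic_rounding (h k : R) : 0 <= k -> k <= h / 3 -> h / 3 < k + 1 ->
  h ^+ 2 / 18 - 2 <= k * h - k - k ^+ 2 - k ^+ 2 / 2.
Proof.
move=> k0 kh hk; pose e := h / 3 - k.
have e0 : 0 <= e by rewrite /e; lra.
have e1 : e < 1 by rewrite /e; lra.
have hE : h = 3 * (k + e) by rewrite /e; lra.
have : 0 <= (k + e - 1) ^+ 2 by exact: sqr_ge0.
rewrite hE; nra.
Qed.

Lemma netrow_lower (L : R) (x : 'I_n -> option bool) (v : 'I_n -> R) :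
  (0 < n)%N -> 0 <= lam -> lam ^+ 2 * (L * n%:R) = 1 ->
  \sum_j sign3 (x j) ^+ 2 * trunc2 n%:R (v j) ^+ 2 <= L * n%:R ->
  expR ((lam * \sum_j trunc2 n%:R (v j) * sign3 (x j)) ^+ 2 / 18 - 2) <= netrow x v.
Proof.
move=> n0 lam0 lamE hS; set xi := \sum_j _; set S := \sum_j _ in hS.
pose h := lam * `|xi|.
have h0 : 0 <= h by rewrite mulr_ge0.
have h2 : (lam * xi) ^+ 2 = h ^+ 2 by rewrite /h !exprMn real_normK ?num_real.
have hn : h ^+ 2 <= n%:R.
  rewrite -h2 exprMn.
  have xiS : xi ^+ 2 <= n%:R * S.
    have -> : xi = \sum_j 1 * (trunc2 n%:R (v j) * sign3 (x j)).
      by apply: eq_bigr => j _; rewrite mul1r.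
    apply: (le_trans (cauchy_schwarz_sum _ _)).
    rewrite {1}/sqnorm; under eq_bigr do rewrite expr1n.
    rewrite sumr_const card_ord ler_wpM2l// le_eqVlt; apply/orP; left.
    by apply/eqP; apply: eq_bigr => j _; rewrite exprMn mulrC.
  apply: (@le_trans _ _ (lam ^+ 2 * (n%:R * (L * n%:R)))).
    by rewrite ler_wpM2l ?sqr_ge0// (le_trans xiS)// ler_wpM2l.
  by rewrite mulrCA lamE mulr1.
(* [k] is the optimal slope rounded down. It stays within the net because [k <= h^2 <= n]; the
   Boolean of the index is chosen to match the sign of [xi]. *)
have := truncn_itv (divr_ge0 h0 (ler0n _ 3)); set k := Num.truncn _ => /andP[k1 k2].
have kn : (k < n.+1)%N.
  rewrite ltnS; have [->//|k0] := posnP k.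
  rewrite -(ler_nat R); apply: le_trans hn.
  have k1' : (1 : R) <= k%:R by rewrite ler1n.
  nra.
pose m : 'I_n.+1 * bool := (Ordinal kn, 0 <= xi).
apply: le_trans (netrow_ge x v m).
have -> : netweight m * \prod_j netterm (x j) m (v j) =
   expR (k%:R * h - (k%:R * lam) ^+ 2 * S / 2 - (k%:R + k%:R ^+ 2)).
  rewrite -expR_sum -expRD /=; congr expR; rewrite addrC sumrB; congr (_ - _ - _).
    under eq_bigr do rewrite -mulrA [sign3 _ * _]mulrC.
    rewrite -big_distrr /= -/xi /slope /= /h.
    by case: (ger0P xi) => _; ring.
  rewrite /S [in RHS]big_distrr [in RHS]big_distrl /=.
  apply: eq_bigr => j _; rewrite /slope /=.
  have : ((if 0 <= xi then 1 else -1) : R) ^+ 2 = 1.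
    by case: ifP; rewrite ?sqrrN expr1n.
  by rewrite !exprMn => ->; ring.
rewrite ler_expR h2.
have k1' : k%:R <= h / 3 := k1.
have := @quadratic_rounding h k%:R (ler0n _ _) k1' _; rewrite natr1 => /(_ k2).
have : (k%:R * lam) ^+ 2 * S <= k%:R ^+ 2.
  rewrite exprMn -mulrA -[leRHS]mulr1 -lamE ler_wpM2l ?sqr_ge0//.
  by rewrite ler_wpM2l ?sqr_ge0.
lra.
Qed.

(** The summand of [netV] at [x] alone stays below [exp (6 n)]. Adding the exponents of the [n] rows
    gives [lam^2 s / 18 - 2 n <= 6 n], whence 144 = 18 * 8. *)
Lemma netV_bound (L : R) (A : 'I_n -> 'I_n -> R) (x : 'I_n -> option bool) :
  (0 < n)%N -> 0 <= lam -> lam ^+ 2 * (L * n%:R) = 1 -> netV A <= expR (6 * n%:R) ->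
  (forall i, \sum_j sign3 (x j) ^+ 2 * trunc2 n%:R (A i j) ^+ 2 <= L * n%:R) ->
  sqnorm (matvec (fun i j => trunc2 n%:R (A i j)) (fun j => sign3 (x j))) <= 144 * L * n%:R ^+ 2.
Proof.
move=> n0 lam0 lamE hV hx.
set s := sqnorm _.
have h : expR (lam ^+ 2 * s / 18 - 2 * n%:R) <= expR (6 * n%:R).
  apply: le_trans hV; rewrite /netV (bigD1 [ffun j => x j])//=.
  apply: (@le_trans _ _ (\prod_i netrow [ffun j => x j] (A i))); last first.
    by rewrite lerDl sumr_ge0// => ? _; rewrite prodr_ge0// => i _; exact: netrow_ge0.
  have -> : expR (lam ^+ 2 * s / 18 - 2 * n%:R) =
     \prod_i expR ((lam * \sum_j trunc2 n%:R (A i j) * sign3 (x j)) ^+ 2 / 18 - 2).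
    rewrite -expR_sum sumrB sumr_const card_ord [2 * n%:R]mulr_natr; congr (expR (_ - _)).
    by rewrite /s /sqnorm big_distrr big_distrl; apply: eq_bigr => i _; rewrite exprMn.
  apply: ler_prod => i _; rewrite expR_ge0 /=.
  have := @netrow_lower L x (A i) n0 lam0 lamE (hx i).
  rewrite /netrow; under [X in _ -> _ <= X]eq_bigr do under eq_bigr do rewrite ffunE.
  by [].
move: h; rewrite ler_expR => h.
have Ln0 : 0 <= L * n%:R.
  apply: le_trans (hx (Ordinal n0)); apply: sumr_ge0 => j _.
  by rewrite mulr_ge0 ?sqr_ge0.
have -> : s = lam ^+ 2 * s * (L * n%:R) by rewrite mulrAC lamE mul1r.
have : lam ^+ 2 * s <= 144 * n%:R by lra.
by move=> /(ler_wpM2r Ln0) /le_trans; apply; rewrite le_eqVlt; apply/orP; left; apply/eqP; ring.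
Qed.

End sign_net.

(** * Counting removed columns *)

Lemma card_bigcup_le (I J : finType) (D : I -> {set J}) :
  (#|(\bigcup_i D i)%SET| <= \sum_i #|D i|)%N.
Proof.
elim/big_rec2: _ => [|i m S _ IH]; first by rewrite cards0.
by apply: leq_trans (leq_card_setU _ _) _; rewrite leq_add2l.
Qed.

(** The exponential of a count, as a product over entries so that independence applies. *)
Definition hugeW (R : realType) (n : nat) (T : R) (A : 'I_n -> 'I_n -> R) : R :=
  \prod_i \prod_j expR (T < A i j ^+ 2)%R%:R.

Lemma card_le_exp_prod (R : realType) (I : finType) (D : {set I}) (w : I -> R) (a : R) :
  (forall i, 1 <= w i) -> (forall i, i \in D -> expR 1 <= w i) ->
  \prod_i w i <= expR a -> #|D|%:R <= a.
Proof.
move=> w1 wD h; rewrite -ler_expR; apply: le_trans h.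
have -> : expR #|D|%:R = \prod_i expR (i \in D)%:R :> R.
  by rewrite -expR_sum -natr_sum -sum1_card big_mkcond.
apply: ler_prod => i _; rewrite expR_ge0 /=.
by case: (boolP (i \in D)) => [/wD//|_]; rewrite expR0.
Qed.

(** * The deterministic bound *)

Section deterministic.
Context (R : realType) (n : nat) (L eps : R) (A : 'I_n -> 'I_n -> R).
Hypothesis n0 : (0 < n)%N.
Hypothesis L_ge1 : 1 <= L.
Hypothesis eps0 : 0 < eps.
(** Four removals of columns share the budget [eps * n] equally. *)
Let b := eps * n%:R / 4.

Lemma row_removal : \prod_i rowW L (A i) <= expR b ->
  exists2 J : {set 'I_n}, #|J|%:R <= b &
    forall i, \sum_(j | j \notin J) Num.min (A i j ^+ 2) n%:R <= L * n%:R.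
Proof.
move=> hW.
have [D D1 D2] := fin_all_exists2 (fun i => row_selection L_ge1 (A i) n0).
exists (\bigcup_i D i)%SET.
  rewrite -ler_expR; apply: le_trans hW.
  apply: (@le_trans _ _ (\prod_i expR #|D i|%:R)).
    by rewrite -expR_sum ler_expR -natr_sum ler_nat card_bigcup_le.
  by apply: ler_prod => i _; rewrite expR_ge0 D1.
move=> i; apply: le_trans (D2 i).
rewrite [leLHS]big_mkcond [leRHS]big_mkcond; apply: ler_sum => j _ /=.
case: ifPn => hj; case: ifPn => hj' //.
  by case/negP: hj; apply/bigcupP; exists i => //; apply/negPn.
by rewrite le_min sqr_ge0 ler0n.
Qed.

Lemma column_removal : \prod_j rowW L (fun i => A i j) <= expR b ->
  exists2 J : {set 'I_n}, #|J|%:R <= b &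
    forall j, j \notin J -> \sum_i Num.min (A i j ^+ 2) n%:R <= L * n%:R.
Proof.
move=> hW; exists [set j | L * n%:R < \sum_i Num.min (A i j ^+ 2) n%:R]%SET.
  apply: card_le_exp_prod hW => [j|j]; first exact: rowW_ge1.
  by rewrite inE => h; apply: rowW_bad.
by move=> j; rewrite inE -leNgt.
Qed.

Lemma huge_removal T : hugeW T A <= expR b ->
  exists2 J : {set 'I_n}, #|J|%:R <= b &
    forall i j, j \notin J -> A i j ^+ 2 <= T.
Proof.
rewrite /hugeW exchange_big /= => hW; exists [set j | [exists i, T < A i j ^+ 2]]%SET.
  apply: card_le_exp_prod hW => j; rewrite -expR_sum.
    by rewrite -expR0 ler_expR; apply: sumr_ge0.
  rewrite inE => /existsP[i hi]; rewrite ler_expR (bigD1 i)//= hi lerDl.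
  exact: sumr_ge0.
move=> i j; rewrite inE => /existsPn/(_ i); by rewrite -leNgt.
Qed.

Lemma column_removal_bound (lam : R) : 12 <= eps * n%:R ->
  0 <= lam -> lam ^+ 2 * (L * n%:R) = 1 ->
  \prod_i rowW L (A i) <= expR b -> \prod_j rowW L (fun i => A i j) <= expR b ->
  hugeW (48 * n%:R / eps) A <= expR b -> netV lam A <= expR (6 * n%:R) ->
  exists2 J : {set 'I_n}, #|J|%:R <= eps * n%:R &
    forall x, (forall j, j \in J -> x j = 0) ->
      sqnorm (matvec A x) <= (120 * L) ^+ 2 * (n%:R / eps) * sqnorm x.
Proof.
move=> en lam0 lamE hW hWt hH hV.
have [J1 c1 h1] := row_removal hW.
have [J2 c2 h2] := column_removal hWt.
have [J3 c3 h3] := huge_removal hH.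
pose J0 := (J1 :|: J2 :|: J3)%SET.
have N0 : 0 < n%:R :> R by rewrite ltr0n.
have L0 : 0 <= L := le_trans ler01 L_ge1.
pose B i j := if j \in J0 then 0 else trunc2 n%:R (A i j).
pose M i j := if (j \in J0) || (A i j ^+ 2 <= n%:R) then 0 else A i j.
have row0 i : \sum_(j | j \notin J0) Num.min (A i j ^+ 2) n%:R <= L * n%:R.
  apply: le_trans (h1 i).
  rewrite [leLHS]big_mkcond [leRHS]big_mkcond; apply: ler_sum => j _ /=.
  rewrite /J0 !inE; case: (j \in J1) => //=.
  by case: ifP => //; rewrite le_min sqr_ge0 ler0n.
have cube x : (forall j, `|x j| <= 1) -> sqnorm (matvec B x) <= 144 * L * n%:R ^+ 2.
  apply: sqnorm_matvec_cube => {}x hx.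
  (* Columns in [J0] get the value 0, so a vector of the net represents the signs on the kept
     columns. *)
  pose o j := if j \in J0 then None else Some (x j == 1).
  have oE j : sign3 R (o j) = if j \in J0 then 0 else x j.
    rewrite /o; case: ifP => //= _; case: (hx j) => ->; rewrite ?eqxx//.
    by rewrite (_ : (-1 == 1 :> R) = false)//; apply/negbTE; rewrite lt_eqF//; lra.
  have -> : sqnorm (matvec B x) =
      sqnorm (matvec (fun i j => trunc2 n%:R (A i j)) (fun j => sign3 R (o j))).
    apply: eq_bigr => i _; congr (_ ^+ 2); apply: eq_bigr => j _.
    by rewrite oE /B; case: ifP; rewrite ?mulr0 ?mul0r.
  apply: (netV_bound n0 lam0 lamE hV) => i.
  apply: le_trans (row0 i); rewrite [leRHS]big_mkcond; apply: ler_sum => j _ /=.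
  rewrite oE; case: ifP => _; first by rewrite expr0n mul0r.
  apply: le_trans (trunc2_sqr _ (ler0n _ n)).
  by case: (hx j) => ->; rewrite ?sqrrN expr1n mul1r.
have [J4 c4 h4] := column_selection (Num.truncn b) cube.
have b0 : 0 <= b by rewrite /b !mulr_ge0// ltW.
have /andP[t1 t2] := truncn_itv b0.
have T0 : 0 <= 48 * n%:R / eps by rewrite divr_ge0 ?mulr_ge0// ltW.
have hM x : sqnorm (matvec M x) <= L * L * (48 * n%:R / eps) * sqnorm x.
  (* A large kept entry accounts for a full [n] in the truncated sum of its row and of its column,
     so at most [L] of them fit in each. *)
  pose S i j := (j \notin J0) && (n%:R < A i j ^+ 2).
  have S_le i j : (S i j)%:R * n%:R <= Num.min (A i j ^+ 2) n%:R.
    rewrite /S; case: (j \notin J0) => /=.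
      case: (ltP n%:R (A i j ^+ 2)) => h.
        by rewrite mul1r.
      by rewrite mul0r sqr_ge0.
    by rewrite mul0r le_min sqr_ge0 ler0n.
  apply: (@sparse_bound _ _ _ M S) => [||i|j|i j] //.
  - rewrite -(ler_pM2r N0) big_distrl /=; apply: le_trans (row0 i).
    rewrite [leRHS]big_mkcond; apply: ler_sum => j _ /=; case: ifPn => hj; first exact: S_le.
    by rewrite /S (negbTE hj) mul0r.
  - rewrite -(ler_pM2r N0) big_distrl /=.
    have [jJ|jJ] := boolP (j \in J0).
      rewrite big1 ?mulr_ge0//.
      by move=> i _; rewrite /S jJ mul0r.
    apply: (@le_trans _ _ (\sum_i Num.min (A i j ^+ 2) n%:R)).
      by apply: ler_sum => i _; exact: S_le.
    by apply: h2; move: jJ; rewrite /J0 !inE !negb_or => /andP[/andP[]].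
  - rewrite /M /S; case: (boolP (j \in J0)) => jJ /=; first by rewrite expr0n mulr0.
    case: (leP (A i j ^+ 2) n%:R) => /= _; first by rewrite expr0n mulr0.
    by rewrite mulr1; apply: h3; move: jJ; rewrite /J0 !inE !negb_or => /andP[].
exists (J0 :|: J4)%SET.
  have : (#|(J0 :|: J4)%SET| <= #|J1| + #|J2| + #|J3| + #|J4|)%N.
    apply: leq_trans (leq_card_setU _ _) _; rewrite leq_add2r.
    apply: leq_trans (leq_card_setU _ _) _; rewrite leq_add2r.
    exact: leq_card_setU.
  rewrite -(ler_nat R) !natrD.
  have : #|J4|%:R <= b by apply: le_trans t1; rewrite ler_nat.
  rewrite /b in c1 c2 c3 *; lra.
move=> x hx.
have -> : sqnorm (matvec A x) = sqnorm (fun i => matvec B x i + matvec M x i).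
  apply: eq_bigr => i _; congr (_ ^+ 2); rewrite -big_split; apply: eq_bigr => j _ /=.
  rewrite /B /M /trunc2; case: ifP => jJ /=.
    by rewrite hx ?mulr0 ?addr0// inE jJ.
  by case: ifP; rewrite ?mul0r ?addr0 ?add0r.
apply: (le_trans (sqnormD_le _ _)).
have hB : sqnorm (matvec B x) * (Num.truncn b)%:R <= 8 * (144 * L * n%:R ^+ 2) * sqnorm x.
  by apply: h4 => j jJ; apply: hx; rewrite inE jJ orbT.
(* [eps * n >= 12] means [b >= 3], so rounding [b] down loses at most a third. *)
have tb : b * (2 / 3) <= (Num.truncn b)%:R.
  move: t2; rewrite -natr1 => t2; have : 3 <= b by rewrite /b; lra.
  lra.
have s0 := sqnorm_ge0 x.
have q0 := sqnorm_ge0 (matvec B x).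
have hB' : sqnorm (matvec B x) <= 48 * 144 * L ^+ 2 * n%:R / eps * sqnorm x.
  have en0 : 0 < eps * n%:R by rewrite mulr_gt0.
  rewrite -(ler_pM2r en0).
  have -> : 48 * 144 * L ^+ 2 * n%:R / eps * sqnorm x * (eps * n%:R) =
            48 * 144 * L ^+ 2 * n%:R ^+ 2 * sqnorm x by field; rewrite gt_eqF.
  apply: (@le_trans _ _ (6 * (sqnorm (matvec B x) * (Num.truncn b)%:R))).
    have := ler_wpM2l q0 tb; rewrite /b; lra.
  apply: (@le_trans _ _ (48 * 144 * L * n%:R ^+ 2 * sqnorm x)); first lra.
  have LL : L <= L ^+ 2 by rewrite expr2 ler_peMl.
  have := ler_wpM2r (mulr_ge0 (sqr_ge0 n%:R) s0) LL; lra.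
pose U := L ^+ 2 * (n%:R / eps) * sqnorm x.
have U0 : 0 <= U.
  apply: mulr_ge0 => //; apply: mulr_ge0; first exact: sqr_ge0.
  by apply: divr_ge0 => //; exact: ltW.
(* The constants combine as [2 * (48 * 144 + 48) = 13920 <= 120 ^ 2]. *)
have -> : (120 * L) ^+ 2 * (n%:R / eps) * sqnorm x = 120 * (120 * U) by rewrite /U; ring.
have hB2 : sqnorm (matvec B x) <= 48 * (144 * U).
  by apply: (le_trans hB'); rewrite le_eqVlt; apply/orP; left; apply/eqP; rewrite /U; ring.
have hM2 : sqnorm (matvec M x) <= 48 * U.
  by apply: (le_trans (hM x)); rewrite le_eqVlt; apply/orP; left; apply/eqP; rewrite /U; ring.
by move: (sqnorm (matvec B x)) (sqnorm (matvec M x)) U U0 hB2 hM2 => u v V *; lra.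
Qed.

End deterministic.

(** * Products of independent variables *)

Section independence.
Context (d : measure_display) (T : measurableType d) (R : realType).
Context (P : probability T R).
Local Open Scope ereal_scope.
Import HBNNSimple.

Lemma integral_nnsfun_comp (X : T -> R) (Z : T -> R) (h : {nnsfun R >-> R}) :
  measurable_fun setT X -> measurable_fun setT Z -> (forall w, (0 <= Z w)%R) ->
  \int[P]_w (h (X w) * Z w)%:E =
  \sum_(y \in range h) y%:E * \int[P]_w (\1_(h @^-1` [set y]) (X w) * Z w)%:E.
Proof.
move=> mX mZ Z0.
transitivity (\int[P]_w (\sum_(y \in range h)
    (y * (\1_(h @^-1` [set y]) (X w) * Z w))%:E)).
  apply: eq_integral => w _; rewrite fsumEFin// [in LHS]fimfunE.
  rewrite !fsbig_finite//= big_distrl /=; congr EFin.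
  by apply: eq_bigr => y _; rewrite mulrA.
have mi y : measurable_fun setT (fun w => \1_(h @^-1` [set y]) (X w) : R).
  by apply: measurableT_comp => //; exact: measurable_indic.
rewrite ge0_integral_fsum//; last 2 first.
  - move=> y; apply/measurable_EFinP; apply: measurable_funM => //.
    by apply: measurable_funM.
  - move=> y w _; rewrite lee_fin mulrA mulr_ge0//.
    by have := nnfun_muleindic_ge0 h y (X w); rewrite -EFinM lee_fin.
apply: eq_fsbigr => y; rewrite inE => -[a _ <-].
under eq_integral do rewrite EFinM.
rewrite ge0_integralZl//.
- by apply/measurable_EFinP; apply: measurable_funM.
- by move=> w _; rewrite lee_fin mulr_ge0.
- by rewrite lee_fin.
Qed.

Lemma cvg_integral_nnsfun (X : T -> R) (Z : T -> R) (f : R -> R)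
    (mf : measurable_fun setT (EFin \o f)) :
  measurable_fun setT X -> measurable_fun setT Z -> (forall w, (0 <= Z w)%R) ->
  (forall a, (0 <= f a)%R) ->
  (fun n => \int[P]_w (nnsfun_approx measurableT mf n (X w) * Z w)%:E) @ \oo -->
  \int[P]_w (f (X w) * Z w)%:E.
Proof.
move=> mX mZ Z0 f0; pose h := nnsfun_approx measurableT mf.
have -> : (fun w => (f (X w) * Z w)%:E) =
   (fun w => limn (fun n => (h n (X w) * Z w)%:E)).
  apply/funext => w; apply/esym/cvg_lim => //.
  rewrite (_ : (fun n => (h n (X w) * Z w)%:E) = (fun n => (h n (X w))%:E * (Z w)%:E)).
    rewrite EFinM; apply: cvgeZr => //.
    by apply: (@cvg_nnsfun_approx _ _ _ _ measurableT _ mf) => //= x _; rewrite lee_fin.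
  by apply/funext => n; rewrite EFinM.
apply: cvg_monotone_convergence => //.
- move=> n; apply/measurable_EFinP; apply: measurable_funM => //.
  exact: measurableT_comp.
- by move=> n w _; rewrite lee_fin mulr_ge0.
- move=> w _ a b ab; rewrite lee_fin ler_wpM2r//.
  by have /lefP := nd_nnsfun_approx measurableT mf ab; apply.
Qed.

(** Linearity passes from indicators to simple functions, monotone convergence from these to [f]. In
    use, [Z] is the product of the other factors and [c] the product of their expectations. *)
Lemma integral_indep_ext (X : T -> R) (Z : T -> R) (c : \bar R) (f : R -> R) :
  measurable_fun setT X -> measurable_fun setT Z -> (forall w, (0 <= Z w)%R) ->
  c \is a fin_num ->
  (forall B, measurable B -> \int[P]_w (\1_B (X w) * Z w)%:E = P (X @^-1` B) * c) ->
  measurable_fun setT f -> (forall a, (0 <= f a)%R) ->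
  \int[P]_w (f (X w) * Z w)%:E = (\int[P]_w (f (X w))%:E) * c.
Proof.
move=> mX mZ Z0 cfin hB mf f0.
have mfE : measurable_fun setT (EFin \o f) by apply/measurable_EFinP.
have l1 := cvg_integral_nnsfun mfE mX mZ Z0 f0.
have l2 : (fun n => \int[P]_w (nnsfun_approx measurableT mfE n (X w) * 1)%:E) @ \oo -->
    \int[P]_w (f (X w) * 1)%:E.
  by apply: cvg_integral_nnsfun => //; exact: measurable_cst.
have e h : \int[P]_w ((h : {nnsfun R >-> R}) (X w) * Z w)%:E =
    \int[P]_w (h (X w) * 1)%:E * c.
  rewrite integral_nnsfun_comp// integral_nnsfun_comp//.
  rewrite ge0_mule_fsuml; last first.
    move=> y; have [y0|y0] := leP 0%R y.
      by rewrite mule_ge0// integral_ge0// => w _; rewrite lee_fin mulr1.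
    rewrite preimage_nnfun0// integral0_eq ?mule0// => w _.
    by rewrite indic0 mul0r.
  apply: eq_fsbigr => y _; rewrite -muleA; congr (_ * _).
  rewrite hB//; congr (_ * _).
  under eq_integral do rewrite mulr1.
  rewrite (_ : (fun w => (\1_(h @^-1` [set y]) (X w))%:E) =
               (fun w => (\1_(X @^-1` (h @^-1` [set y])) w)%:E)) //.
  by rewrite integral_indic ?setIT// -[X in measurable X]setTI; apply: mX.
transitivity (limn (fun n => \int[P]_w (nnsfun_approx measurableT mfE n (X w) * Z w)%:E)).
  by apply/esym/cvg_lim.
apply/cvg_lim => //.
rewrite (_ : (fun n => _) = (fun n => \int[P]_w (nnsfun_approx measurableT mfE n (X w) * 1)%:E * c)).
  apply: cvgeZr => //.
  by under [X in _ --> X]eq_integral do rewrite -[f _]mulr1.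
by apply/funext => n; exact: e.
Qed.

End independence.

Section product_expectation.
Context (d : measure_display) (T : measurableType d) (R : realType).
Context (P : probability T R) (K : finType) (X : K -> T -> R).
Hypothesis mX : forall k, measurable_fun setT (X k).
Hypothesis indepX : mutually_independent P X.

Lemma measurable_prod_comp (f : K -> R -> R) (Q : pred K) :
  (forall k, measurable_fun setT (f k)) ->
  measurable_fun setT (fun w => \prod_(k | Q k) f k (X k w)).
Proof.
move=> mf; under eq_fun do rewrite -big_filter.
by apply: measurable_prod => k _; apply: measurableT_comp.
Qed.

(** When all factors are indicators this is independence itself. The list [s] holds the indices
    where the factor may be arbitrary; replacing one such factor by indicators reduces to a shorter
    list. *)
Lemma expectation_prod_indep (f : K -> R -> R) :
  (forall k, measurable_fun setT (f k)) -> (forall k a, 0 <= f k a) ->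
  (forall k, \int[P]_w (f k (X k w))%:E < +oo)%E ->
  (\int[P]_w (\prod_k f k (X k w))%:E = \prod_k \int[P]_w (f k (X k w))%:E)%E.
Proof.
suff E (s : seq K) (g : K -> R -> R) : (forall k, measurable_fun setT (g k)) ->
    (forall k a, 0 <= g k a) -> (forall k, \int[P]_w (g k (X k w))%:E < +oo)%E ->
    (forall k, k \notin s -> exists2 B, measurable B & g k = \1_B) ->
  (\int[P]_w (\prod_k g k (X k w))%:E = \prod_k \int[P]_w (g k (X k w))%:E)%E.
  move=> mf f0 ffin; apply: (E (enum K)) => // k; by rewrite mem_enum.
elim: s g => [|l s IH] g mg g0 gfin gB.
  have [B mB gE] := fin_all_exists2 (fun k => gB k isT).
  have mXB k : measurable (X k @^-1` B k).
    by rewrite -[X in measurable X]setTI; exact: mX.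
  have e1 k w : g k (X k w) = \1_(X k @^-1` B k) w by rewrite gE.
  under [in RHS]eq_bigr => k _.
    rewrite (_ : (fun w => (g k (X k w))%:E) = (fun w => (\1_(X k @^-1` B k) w)%:E)).
      rewrite integral_indic// setIT; over.
    by apply/funext => w; rewrite e1.
  have := indepX mB [set: K]%SET.
  rewrite (_ : (\bigcap_(k in _) _) = \bigcap_k (X k @^-1` B k)); last first.
    by apply: eq_bigcapl; split => k // _; rewrite /= inE.
  have <- : (\prod_k P (X k @^-1` B k) = \prod_(k in [set: K]%SET) P (X k @^-1` B k))%E.
    by apply: eq_bigl => k; rewrite inE.
  move=> <-; rewrite -[X in P X]setIT -integral_indic//; last first.
    by apply: fin_bigcap_measurable => // k _; exact: mXB.
  apply: eq_integral => w _; congr EFin.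
  rewrite indicE; case: (boolP (w \in _)) => hw.
    rewrite big1// => k _; rewrite e1 indicE mem_set//.
    by move: hw; rewrite inE => /(_ k I).
  have [k hk] : exists k, ~ (X k @^-1` B k) w.
    apply/existsNP => h; move/negP: hw; apply; rewrite inE => k _; exact: h.
  by rewrite (bigD1 k)//= e1 indicE memNset ?mul0r.
pose Z w := \prod_(k | k != l) g k (X k w).
pose c := (\prod_(k | k != l) \int[P]_w (g k (X k w))%:E)%E.
have Z0 w : 0 <= Z w by apply: prodr_ge0 => k _.
have mZ : measurable_fun setT Z by exact: measurable_prod_comp.
have gfn k : (\int[P]_w (g k (X k w))%:E)%E \is a fin_num.
  by rewrite ge0_fin_numE// integral_ge0// => w _; rewrite lee_fin.
have cfin : c \is a fin_num by apply: prode_fin_num => k _.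
transitivity (\int[P]_w (g l (X l w) * Z w)%:E)%E.
  by apply: eq_integral => w _; rewrite (bigD1 l).
rewrite [RHS](bigD1 l)//=.
apply: (integral_indep_ext (mX l) mZ Z0 cfin _ (mg l) (g0 l)) => B mB.
pose g' k := if k == l then \1_B else g k.
have mXB : measurable (X l @^-1` B) by rewrite -[X in measurable X]setTI; exact: mX.
have eB : (\int[P]_w (\1_B (X l w))%:E = P (X l @^-1` B))%E.
  by rewrite (_ : (fun w => _) = (fun w => (\1_(X l @^-1` B) w)%:E))// integral_indic// setIT.
transitivity (\int[P]_w (\prod_k g' k (X k w))%:E)%E.
  apply: eq_integral => w _; rewrite (bigD1 l)//= /g' eqxx; congr (_ * _)%:E.
  by apply: eq_bigr => k /negPf ->.
rewrite IH.
- rewrite (bigD1 l)//= /g' eqxx eB.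
  by congr (_ * _)%E; apply: eq_bigr => k /negPf ->.
- by move=> k; rewrite /g'; case: eqP => _ //; exact: measurable_indic.
- by move=> k a; rewrite /g'; case: eqP => _ //; rewrite indicE.
- move=> k; rewrite /g'; case: eqP => [->|_//]; rewrite eB.
  by rewrite (le_lt_trans (probability_le1 _ _))// ltry.
- move=> k ks; rewrite /g'; case: eqP => [_|/eqP kl]; first by exists B.
  by apply: gB; rewrite inE negb_or kl.
Qed.

End product_expectation.

(** Centering removes the linear term, unit variance leaves [1 + c], and [1 + c <= exp c] turns
    products of such bounds into the exponential of a sum. *)
Lemma expectation_le_expR (d : measure_display) (T : measurableType d) (R : realType)
    (P : probability T R) (X : T -> R) (f : R -> R) (b c : R) :
  measurable_fun setT X -> P.-integrable setT (EFin \o X) ->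
  (\int[P]_w (X w)%:E = 0)%E -> (\int[P]_w (X w ^+ 2)%:E = 1)%E ->
  measurable_fun setT f -> (forall a, 0 <= f a) -> 0 <= c ->
  (forall a, f a <= 1 + b * a + c * a ^+ 2) ->
  (\int[P]_w (f (X w))%:E <= (expR c)%:E)%E.
Proof.
move=> mX iX E0 E1 mf f0 c0 fle.
have mX2 : measurable_fun setT (fun w => X w ^+ 2) by exact: measurable_funX.
have iX2 : P.-integrable setT (fun w => (X w ^+ 2)%:E).
  apply/integrableP; split; first exact/measurable_EFinP.
  under eq_integral do rewrite gee0_abs ?lee_fin ?sqr_ge0//.
  by rewrite E1 ltry.
have i1 : P.-integrable setT (fun=> 1%:E : \bar R).
  by apply: finite_measure_integrable_cst.
have ibX : P.-integrable setT (fun w => (b%:E * (X w)%:E)%E) by apply: integrableZl.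
have icX : P.-integrable setT (fun w => (c%:E * (X w ^+ 2)%:E)%E) by apply: integrableZl.
apply: (@le_trans _ _ (\int[P]_w (1%:E + b%:E * (X w)%:E + c%:E * (X w ^+ 2)%:E))%E).
  apply: ge0_le_integral => //.
  - by move=> w _; rewrite lee_fin.
  - by apply/measurable_EFinP; apply: measurableT_comp.
  - by apply: (measurable_int P); apply: integrableD => //; apply: integrableD.
  - by move=> w _; rewrite -!EFinM -!EFinD lee_fin.
rewrite integralD//; last by apply: integrableD.
have I1 : (\int[P]_w (1 : \bar R) = 1)%E.
  by rewrite integral_cst// mul1e; exact: probability_setT.
rewrite integralD// !integralZl// E0 E1 I1.
by rewrite mule0 adde0 mule1 -EFinD lee_fin expR_ge1Dx.
Qed.

(** * Expectations of products and mixtures *)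

Section random_matrix.
Context (d : measure_display) (T : measurableType d) (R : realType).
Context (P : probability T R).

(* The only consequence of independence and of the moment hypotheses that is used;
   in this form it passes to the transposed matrix. *)
Definition product_bounded (I J : finType) (A : I -> J -> T -> R) : Prop :=
  (forall i j, measurable_fun setT (A i j)) /\
  forall (g : I -> J -> R -> R) (b c : I -> J -> R),
    (forall i j, measurable_fun setT (g i j)) -> (forall i j a, 0 <= g i j a) ->
    (forall i j, 0 <= c i j) ->
    (forall i j a, g i j a <= 1 + b i j * a + c i j * a ^+ 2) ->
    (\int[P]_w (\prod_i \prod_j g i j (A i j w))%:E <=
     (expR (\sum_i \sum_j c i j))%:E)%E.

Lemma product_bounded_indep (I J : finType) (A : I -> J -> T -> R) :
  (forall i j, measurable_fun setT (A i j)) ->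
  mutually_independent P (fun k : I * J => A k.1 k.2) ->
  (forall i j, P.-integrable setT (EFin \o A i j)) ->
  (forall i j, (\int[P]_w (A i j w)%:E = 0)%E) ->
  (forall i j, (\int[P]_w ((A i j w) ^+ 2)%:E = 1)%E) ->
  product_bounded A.
Proof.
move=> mA iA intA E0 E1; split => // g b c mg g0 c0 gle.
have le1 (k : I * J) : (\int[P]_w (g k.1 k.2 (A k.1 k.2 w))%:E <= (expR (c k.1 k.2))%:E)%E.
  by apply: (@expectation_le_expR _ _ _ P (A k.1 k.2) (g k.1 k.2) (b k.1 k.2)).
have -> : (fun w => (\prod_i \prod_j g i j (A i j w))%:E) =
    (fun w => (\prod_(k : I * J) g k.1 k.2 (A k.1 k.2 w))%:E).
  by apply/funext => w; rewrite pair_big.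
rewrite (expectation_prod_indep (f := fun k => g k.1 k.2) (fun k => mA k.1 k.2) iA)//.
- rewrite pair_big /= expR_sum.
  apply: (proj2 (big_ind2 (fun (x : \bar R) (y : R) => 0 <= x /\ x <= y%:E)%E _ _ _)) => //=.
  + move=> x1 y1 x2 y2 [x10 xy1] [x20 xy2]; split; first exact: mule_ge0.
    by rewrite EFinM lee_pmul.
  + move=> k _; split => //.
    by apply: integral_ge0 => w _; rewrite lee_fin.
- by move=> k; apply: le_lt_trans (le1 k) _; rewrite ltry.
Qed.

Lemma product_bounded_tr (I J : finType) (A : I -> J -> T -> R) :
  product_bounded A -> product_bounded (fun j i => A i j).
Proof.
move=> [mA hA]; split => [//|g b c mg g0 c0 gle].
rewrite exchange_big /=; under eq_integral do rewrite exchange_big /=.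
exact: (hA (fun i j => g j i) (fun i j => b j i) (fun i j => c j i)).
Qed.

Section mixture.
Context (I J M : finType) (A : I -> J -> T -> R).
Context (r : M -> R) (g : I -> M -> J -> R -> R) (b c : I -> M -> J -> R).
Hypothesis hA : product_bounded A.
Hypothesis r0 : forall m, 0 <= r m.
Hypothesis mg : forall i m j, measurable_fun setT (g i m j).
Hypothesis g0 : forall i m j a, 0 <= g i m j a.
Hypothesis c0 : forall i m j, 0 <= c i m j.
Hypothesis gle : forall i m j a, g i m j a <= 1 + b i m j * a + c i m j * a ^+ 2.

Lemma measurable_mixture :
  measurable_fun setT (fun w => \prod_i \sum_m r m * \prod_j g i m j (A i j w)).
Proof.
apply: measurable_prod => i _; apply: measurable_sum => m.
apply: measurable_funM => //; apply: measurable_prod => j _.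
by apply: measurableT_comp => //; exact: hA.1.
Qed.

(** Expanding the product of sums gives one term per choice [f] of an index in each row. Such a term
    is a product over all entries, so [product_bounded] applies, and the sum folds back. *)
Lemma expectation_mixture :
  (\int[P]_w (\prod_i \sum_m r m * \prod_j g i m j (A i j w))%:E <=
   (\prod_i \sum_m r m * expR (\sum_j c i m j))%:E)%E.
Proof.
under eq_integral do rewrite bigA_distr_bigA /= -sumEFin.
have mp (f : {ffun I -> M}) :
    measurable_fun setT (fun w => \prod_i \prod_j g i (f i) j (A i j w)).
  apply: measurable_prod => i _; apply: measurable_prod => j _.
  by apply: measurableT_comp => //; exact: hA.1.
have p0 (f : {ffun I -> M}) w : 0 <= \prod_i \prod_j g i (f i) j (A i j w).
  by apply: prodr_ge0 => i _; apply: prodr_ge0.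
have rp0 (f : {ffun I -> M}) : 0 <= \prod_i r (f i) by apply: prodr_ge0.
rewrite ge0_integral_sum//; last 2 first.
- move=> f; apply/measurable_EFinP; under eq_fun do rewrite big_split.
  exact: measurable_funM.
- by move=> f w _; rewrite lee_fin big_split mulr_ge0.
rewrite bigA_distr_bigA /= -sumEFin; apply: lee_sum => f _.
under eq_integral do rewrite big_split EFinM.
rewrite ge0_integralZl//; [|by apply/measurable_EFinP; exact: mp|by move=> w _; rewrite lee_fin|by rewrite lee_fin].
rewrite big_split EFinM lee_wpmul2l ?lee_fin//= -expR_sum.
exact: (hA.2 (fun i j => g i (f i) j) (fun i j => b i (f i) j) (fun i j => c i (f i) j)).
Qed.

End mixture.

Lemma markov_expR (W : T -> R) (a c : R) :
  measurable_fun setT W -> (forall w, 0 <= W w) ->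
  (\int[P]_w (W w)%:E <= (expR c)%:E)%E ->
  measurable [set w | expR a < W w] /\
  (P [set w | (expR a < W w)%R] <= (expR (c - a))%:E)%E.
Proof.
move=> mW W0 hW; set S := [set w | _].
have mS : measurable S.
  rewrite (_ : S = W @^-1` `]expR a, +oo[).
    by rewrite -[X in measurable X]setTI; apply: mW.
  by apply/seteqP; split => w /=; rewrite in_itv /= andbT.
split => //.
have h : ((expR a)%:E * P S <= (expR c)%:E)%E.
  apply: le_trans hW; rewrite -[X in P X]setIT -integral_indic// -ge0_integralZl//.
  - apply: ge0_le_integral => //.
    + by apply/measurable_EFinP; apply: measurable_funM => //; exact: measurable_indic.
    + exact/measurable_EFinP.
    + move=> w _; rewrite -EFinM lee_fin indicE; case: (boolP (w \in S)).
        by rewrite inE mulr1 => /ltW.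
      by rewrite mulr0.
  - by apply/measurable_EFinP; exact: measurable_indic.
rewrite -(@lee_pmul2l _ (expR a)%:E)// ?lte_fin ?expR_gt0//.
by apply: (le_trans h); rewrite -EFinM lee_fin -expRD addrC subrK.
Qed.

End random_matrix.

(** * Elementary exponential and geometric inequalities *)

Section numeric.
Context (R : realType).
Implicit Types s q y : R.

Lemma expR_half_le s : 0 <= s -> s <= 1 -> expR (s / 2) <= 1 + s.
Proof.
move=> s0 s1; have := expR_ge1Dx (- (s / 2)); rewrite expRN => h.
have e0 := expR_gt0 (s / 2).
have : (1 + - (s / 2)) * expR (s / 2) <= 1.
  by rewrite -ler_pdivlMr// mul1r.
nra.
Qed.

(** Sixth power of [expR_half_le]; since [s ^ k <= s], the nonconstant coefficients of [(1 + s) ^ 6]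
    add up to 63. *)
Lemma expR3_le s : 0 <= s -> s <= 1 -> expR (3 * s) <= 1 + 63 * s.
Proof.
move=> s0 s1; have -> : 3 * s = 6%:R * (s / 2) by field.
rewrite expRM_natl; apply: (@le_trans _ _ ((1 + s) ^+ 6)).
  by apply: lerXn2r; rewrite ?nnegrE ?expR_ge0 ?addr_ge0// expR_half_le.
have P k : s ^+ k.+1 <= s by rewrite exprS ler_piMr// exprn_ile1.
have := P 1%N; have := P 2%N; have := P 3%N; have := P 4%N; have := P 5%N.
have -> : (1 + s) ^+ 6 =
  1 + 6 * s + 15 * s ^+ 2 + 20 * s ^+ 3 + 15 * s ^+ 4 + 6 * s ^+ 5 + s ^+ 6 by ring.
lra.
Qed.

Lemma expR1_le4 : expR 1 <= 4 :> R.
Proof.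
have := expR_half_le ler01 (lexx 1); have := expR_gt0 (1 / 2 : R).
have -> : expR 1 = expR (1 / 2) * expR (1 / 2) :> R by rewrite -expRD; congr expR; lra.
nra.
Qed.

Lemma expR1_ge2 : 2 <= expR 1 :> R.
Proof. by apply: le_trans (expR_ge1Dx 1); lra. Qed.

(* Takes the place of a symmetrization of the entries; the proof rests on
   [(1 - y + y^2/2) (1 + y + y^2/2) = 1 + y^4/4]. *)
Lemma expR_sub_sqr y : expR (y - y ^+ 2 / 2) <= 1 + y + y ^+ 2 / 2.
Proof.
have := expR_ge1Dx (- (y - y ^+ 2 / 2)); rewrite expRN => h.
have e0 := expR_gt0 (y - y ^+ 2 / 2).
have h1 : (1 + - (y - y ^+ 2 / 2)) * expR (y - y ^+ 2 / 2) <= 1.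
  by rewrite -ler_pdivlMr// mul1r.
have p0 : 0 < 1 - y + y ^+ 2 / 2 by have := sqr_ge0 (y - 1); lra.
have : 1 <= (1 - y + y ^+ 2 / 2) * (1 + y + y ^+ 2 / 2).
  have : 0 <= y ^+ 4 by exact: exprn_even_ge0.
  lra.
by move=> h2; rewrite -(ler_pM2l p0); lra.
Qed.

Lemma geometric_le q N : 0 <= q -> q < 1 -> \sum_(k < N) q ^+ k <= (1 - q)^-1.
Proof.
move=> q0 q1; have p0 : 0 < 1 - q by rewrite subr_gt0.
rewrite -(ler_pM2l p0) mulfV ?gt_eqF//.
have -> : (1 - q) * \sum_(k < N) q ^+ k = 1 - q ^+ N.
  elim: N => [|N IH]; first by rewrite big_ord0 mulr0 expr0 subrr.
  by rewrite big_ord_recr /= mulrDr IH exprS; ring.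
by rewrite lerBlDl lerDr exprn_ge0.
Qed.

End numeric.

(** * Expectations of the exponential functionals *)

Section functionals.
Context (d : measure_display) (T : measurableType d) (R : realType).
Context (P : probability T R) (n : nat) (A : 'I_n -> 'I_n -> T -> R).
Hypothesis hA : product_bounded P A.
Hypothesis n0 : (0 < n)%N.

Lemma rowterm_le (m : option 'I_n) (a : R) :
  rowterm m a <= 1 + 0 * a + (if m is Some k then 63 / level R n k else 0) * a ^+ 2.
Proof.
case: m => [k|] /=; last by lra.
have l0 := level_gt0 R k n0.
have s0 : 0 <= Num.min (a ^+ 2) (level R n k) / level R n k.
  by rewrite divr_ge0 ?le_min ?sqr_ge0 ?ltW.
have s1 : Num.min (a ^+ 2) (level R n k) / level R n k <= 1.
  by rewrite ler_pdivrMr// mul1r ge_min lexx orbT.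
apply: (le_trans (expR3_le s0 s1)); rewrite mul0r addr0 lerD2l -!mulrA ler_pM2l//.
by rewrite mulrC ler_pM2l ?invr_gt0// ge_min lexx.
Qed.

Lemma measurable_rowterm (m : option 'I_n) : measurable_fun setT (@rowterm R n m).
Proof.
case: m => [k|] /=; last exact: measurable_cst.
apply: measurableT_comp => //; apply: measurable_funM => //.
apply: measurable_funM => //; apply: measurable_minr => //.
Qed.

Lemma rowterm_ge0 (m : option 'I_n) (a : R) : 0 <= rowterm m a.
Proof. by case: m => [k|] //=; exact: expR_ge0. Qed.

Lemma rowweight_ge0 (L : R) (m : option 'I_n) : 0 <= rowweight L m.
Proof. by case: m => [k|] //=; exact: expR_ge0. Qed.

Lemma measurable_rowW (L : R) :
  measurable_fun setT (fun w => \prod_i rowW L (fun j => A i j w)).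
Proof.
exact: (@measurable_mixture _ _ _ P _ _ _ A (rowweight L) (fun _ m _ => rowterm m) hA
  (fun _ m _ => measurable_rowterm m)).
Qed.

(** Level [k] has expectation at most [exp ((63 - L) 2 ^ k)], which for [L >= 64] is below
    [exp (63 - L) / 2 ^ k]; the geometric sum over levels gives the factor 2 for each row. *)
Lemma expectation_rowW (L : R) : 64 <= L ->
  (\int[P]_w (\prod_i rowW L (fun j => A i j w))%:E <=
   (expR (n%:R * (2 * expR (63 - L))))%:E)%E.
Proof.
move=> hL.
pose c (m : option 'I_n) : R := if m is Some k then 63 / level R n k else 0.
have c0 m : 0 <= c m.
  by case: m => [k|] //=; rewrite divr_ge0// ltW// level_gt0.
apply: (le_trans (@expectation_mixture _ _ _ P _ _ _ A (rowweight L)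
  (fun _ m _ => rowterm m) (fun _ _ _ => 0) (fun _ m _ => c m) hA
  (rowweight_ge0 L) (fun _ m _ => measurable_rowterm m) (fun _ m _ => rowterm_ge0 m)
  (fun _ m _ => c0 m) (fun _ m _ => rowterm_le m))).
rewrite lee_fin prodr_const card_ord expRM_natl lerXn2r ?nnegrE ?expR_ge0//.
  by apply: sumr_ge0 => m _; rewrite mulr_ge0 ?rowweight_ge0 ?expR_ge0.
rewrite (bigD1 None)//= big1// expR0 mulr1.
apply: le_trans (expR_ge1Dx _); rewrite lerD2l.
rewrite (reindex_omap Some id) => [|[]//]; rewrite /=.
apply: (@le_trans _ _ (\sum_(k < n) expR (63 - L) * (2^-1) ^+ k)).
  under [leLHS]eq_bigl do rewrite eqxx.
  apply: ler_sum => k _; rewrite /c sumr_const card_ord -expRD.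
  have -> : - (L * 2 ^+ k) + (63 / level R n k) *+ n = (63 - L) * 2 ^+ k.
    have : 2 ^+ k != 0 :> R by rewrite expf_neq0.
    have : n%:R != 0 :> R by rewrite pnatr_eq0 -lt0n.
    rewrite -[(_ / _) *+ n]mulr_natr /level; move: (2 ^+ k) (n%:R) => p q q0 p0.
    by field; rewrite p0.
  have k2 : k%:R + 1 <= 2 ^+ k :> R by rewrite natr1 -natrX ler_nat ltn_expl.
  apply: (@le_trans _ _ (expR (63 - L - k%:R))).
    rewrite ler_expR; move: (2 ^+ k) (k%:R : R) (ler0n R k) k2 => p q q0 pq.
    have -> : (63 - L) * p = 63 - L - (p - 1) - (L - 63 - 1) * (p - 1) by ring.
    have : 0 <= (L - 63 - 1) * (p - 1) by apply: mulr_ge0; lra.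
    by move: ((L - 63 - 1) * (p - 1)) => u u0; lra.
  rewrite expRD ler_wpM2l ?expR_ge0// expRN exprVn lef_pV2 ?posrE ?expR_gt0 ?exprn_gt0//.
  by rewrite -[k%:R]mulr1 expRM_natl lerXn2r ?nnegrE ?expR_ge0// (expR1_ge2 R).
rewrite -big_distrr /= mulrC ler_wpM2r ?expR_ge0//.
have h1 : (1 - 2^-1)^-1 = 2 :> R by field.
have h2 : 0 <= 2^-1 :> R by rewrite invr_ge0.
have h3 : 2^-1 < 1 :> R by rewrite invf_lt1 ?ltr1n.
by have := geometric_le n h2 h3; rewrite h1.
Qed.

Lemma measurable_hugeterm (t : R) : measurable_fun setT (fun a : R => expR (t < a ^+ 2)%R%:R : R).
Proof.
have -> : (fun a : R => expR (t < a ^+ 2)%R%:R : R) =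
    (fun a : R => if t < a ^+ 2 then expR 1 else expR 0).
  by apply/funext => a; case: ifP.
apply: measurable_fun_ifT => //.
by apply: measurable_fun_ltr => //; exact: measurable_funX.
Qed.

Lemma measurable_hugeH (t : R) : measurable_fun setT (fun w => hugeW t (fun i j => A i j w)).
Proof.
apply: measurable_prod => i _; apply: measurable_prod => j _.
by apply: (measurableT_comp (measurable_hugeterm t)); exact: hA.1.
Qed.

(** Above the threshold [a^2 / t >= 1], hence [exp 1 <= 4 <= 1 + 3 a^2 / t]; there are [n^2]
    entries. *)
Lemma expectation_hugeH (t : R) : 0 < t ->
  (\int[P]_w (hugeW t (fun i j => A i j w))%:E <= (expR (3 / t * n%:R ^+ 2))%:E)%E.
Proof.
move=> t0.
have := @hA.2 (fun _ _ a => expR (t < a ^+ 2)%R%:R) (fun _ _ => 0) (fun _ _ => 3 / t)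
  (fun _ _ => measurable_hugeterm t) (fun _ _ _ => expR_ge0 _).
move=> h; have {}h := h _ _.
rewrite (_ : \sum_i \sum_j 3 / t = 3 / t * n%:R ^+ 2) in h; last first.
  by rewrite !sumr_const card_ord -[LHS]mulr_natr -[3 / t *+ n]mulr_natr -mulrA expr2.
apply: h; first by move=> _ _; rewrite divr_ge0// ltW.
move=> _ _ a; rewrite mul0r addr0; case: ltP => h /=.
  apply: (le_trans (expR1_le4 R)).
  have : 1 <= a ^+ 2 / t by rewrite ler_pdivlMr// mul1r ltW.
  by rewrite mulrAC; lra.
by rewrite expR0 lerDl mulr_ge0 ?sqr_ge0// divr_ge0// ltW.
Qed.

Lemma measurable_netterm lam o m : measurable_fun setT (@netterm R n lam o m).
Proof.
have mt : measurable_fun setT (@trunc2 R n%:R).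
  apply: measurable_fun_ifT => //.
  by apply: measurable_fun_ler => //; exact: measurable_funX.
apply: measurableT_comp => //; apply: measurable_funB.
  exact: measurable_funM.
by apply: measurable_funM => //; apply: measurable_funX; exact: measurable_funM.
Qed.

(** Truncation spoils the zero mean. The error occurs only for [a^2 > n], where
    [|a| <= a^2 / sqrt n], so a quadratic term absorbs it. *)
Lemma trunc2_lin_le (s a : R) :
  s * trunc2 n%:R a <= s * a + `|s| / Num.sqrt n%:R * a ^+ 2.
Proof.
have q0 : 0 < Num.sqrt n%:R :> R by rewrite sqrtr_gt0 ltr0n.
rewrite /trunc2; case: (leP (a ^+ 2) n%:R) => h.
  by rewrite lerDl mulr_ge0 ?sqr_ge0// divr_ge0// ltW.
rewrite mulr0.
have h1 : `|a| <= a ^+ 2 / Num.sqrt n%:R.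
  rewrite ler_pdivlMr// -real_normK ?num_real// expr2 ler_wpM2l//.
  by rewrite -sqrtr_sqr ler_sqrt ?sqr_ge0// ltW.
have h2 : - (s * a) <= `|s| * (a ^+ 2 / Num.sqrt n%:R).
  apply: (@le_trans _ _ (`|s| * `|a|)); last by rewrite ler_wpM2l.
  by rewrite -normrM -normrN ler_norm.
have -> : `|s| / Num.sqrt n%:R * a ^+ 2 = `|s| * (a ^+ 2 / Num.sqrt n%:R) by ring.
lra.
Qed.

Lemma netterm_le lam o (m : 'I_n.+1 * bool) (a s : R) : s = slope lam m * sign3 R o ->
  netterm lam o m a <= 1 + s * a + (`|s| / Num.sqrt n%:R + s ^+ 2 / 2) * a ^+ 2.
Proof.
move=> sE; apply: (le_trans (expR_sub_sqr _)); rewrite -sE.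
have h1 := trunc2_lin_le s a.
have h2 : (s * trunc2 n%:R a) ^+ 2 <= s ^+ 2 * a ^+ 2.
  rewrite exprMn ler_wpM2l ?sqr_ge0//; apply: (le_trans (trunc2_sqr _ (ler0n _ n))).
  by rewrite ge_min lexx.
lra.
Qed.

Lemma measurable_netV lam : measurable_fun setT (fun w => netV lam (fun i j => A i j w)).
Proof.
apply: measurable_sum => x.
exact: (@measurable_mixture _ _ _ P _ _ _ A (@netweight R n)
  (fun _ m j => netterm lam (x j) m) hA (fun _ m j => measurable_netterm lam (x j) m)).
Qed.

(** In a row, slope index [k] costs at most [exp (k + k^2 / 2)], and the weight leaves
    [exp (- k^2 / 2) <= (2 / 3) ^ k]. Summed over [k] and both signs this is at most 6, and the
    [3 ^ n] vectors give [18 ^ n <= 2 ^ (5 n) <= exp (5 n)]. *)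
Lemma expectation_netV (L lam : R) : 1 <= L -> 0 <= lam -> lam ^+ 2 * (L * n%:R) = 1 ->
  (\int[P]_w (netV lam (fun i j => A i j w))%:E <= (expR (5 * n%:R))%:E)%E.
Proof.
move=> L1 lam0 lamE.
have N0 : 0 < n%:R :> R by rewrite ltr0n.
have lamn : lam ^+ 2 * n%:R <= 1.
  have : 0 <= lam ^+ 2 * n%:R by rewrite mulr_ge0 ?sqr_ge0// ltW.
  nra.
pose s (o : option bool) (m : 'I_n.+1 * bool) : R := slope lam m * sign3 R o.
pose c o m : R := `|s o m| / Num.sqrt n%:R + s o m ^+ 2 / 2.
have q0 : 0 < Num.sqrt n%:R :> R by rewrite sqrtr_gt0 ltr0n.
have q2 : Num.sqrt n%:R ^+ 2 = n%:R :> R by rewrite sqr_sqrtr// ltW.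
have c0 o m : 0 <= c o m by rewrite /c; apply: addr_ge0; apply: divr_ge0; rewrite ?sqr_ge0 // ltW.
have sle o m : `|s o m| <= m.1%:R * lam.
  rewrite /s /slope !normrM (ger0_norm lam0) (ger0_norm (ler0n _ _)).
  have -> : `|if m.2 then 1 else -1| = 1 :> R by case: m.2; rewrite ?normrN normr1.
  rewrite mul1r ler_piMr ?mulr_ge0//.
  by case: o => [[]|] /=; rewrite ?normrN ?normr1 ?normr0.
have nc o m : n%:R * c o m <= m.1%:R + m.1%:R ^+ 2 / 2.
  have k0 : 0 <= m.1%:R :> R by [].
  have lq : lam * Num.sqrt n%:R <= 1.
    have : (lam * Num.sqrt n%:R) ^+ 2 <= 1 by rewrite exprMn q2.
    by have := sqr_ge0 (lam * Num.sqrt n%:R - 1); move: (lam * _) => u; lra.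
  have h1 : n%:R * (`|s o m| / Num.sqrt n%:R) <= m.1%:R.
    rewrite -[X in X * _]q2 expr2 -mulrA [Num.sqrt _ * (_ / _)]mulrC divfK ?gt_eqF//.
    apply: (@le_trans _ _ (Num.sqrt n%:R * (m.1%:R * lam))); first by rewrite ler_pM2l.
    nra.
  have h2 : n%:R * s o m ^+ 2 <= m.1%:R ^+ 2.
    have : s o m ^+ 2 <= (m.1%:R * lam) ^+ 2.
      by rewrite -(real_normK (num_real (s o m))) lerXn2r ?nnegrE ?mulr_ge0.
    move=> h; apply: (@le_trans _ _ (n%:R * (m.1%:R ^+ 2 * lam ^+ 2))).
      by rewrite (ler_pM2l N0) -exprMn.
    by rewrite mulrCA ler_piMr ?sqr_ge0// mulrC.
  rewrite /c; lra.
under eq_integral do rewrite /netV -sumEFin.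
rewrite ge0_integral_sum//; last 2 first.
- move=> x; apply/measurable_EFinP.
  exact: (@measurable_mixture _ _ _ P _ _ _ A (@netweight R n)
    (fun _ m j => netterm lam (x j) m) hA (fun _ m j => measurable_netterm lam (x j) m)).
- by move=> x w _; rewrite lee_fin prodr_ge0// => i _; exact: netrow_ge0.
have row6 (x : {ffun 'I_n -> option bool}) :
  (\int[P]_w (\prod_i netrow lam x (fun j => A i j w))%:E <= (6 ^+ n)%:E)%E.
  apply: (le_trans (@expectation_mixture _ _ _ P _ _ _ A (@netweight R n)
    (fun _ m j => netterm lam (x j) m) (fun _ m j => s (x j) m) (fun _ m j => c (x j) m) hA
    (fun m => expR_ge0 _) (fun _ m j => measurable_netterm lam (x j) m)
    (fun _ m j a => expR_ge0 _)
    (fun _ m j => c0 (x j) m) (fun _ m j a => @netterm_le lam (x j) m a _ erefl))).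
  rewrite lee_fin prodr_const card_ord lerXn2r ?nnegrE//.
    by apply: sumr_ge0 => m _; rewrite mulr_ge0 ?expR_ge0.
  apply: (@le_trans _ _ (\sum_(m : 'I_n.+1 * bool) (2 / 3) ^+ m.1)).
    apply: ler_sum => m _; rewrite -expRD.
    apply: (@le_trans _ _ (expR (m.1%:R * - (1 / 2)))).
      rewrite ler_expR.
      have : \sum_j c (x j) m <= m.1%:R + m.1%:R ^+ 2 / 2.
        rewrite -(ler_pM2l N0) big_distrr /=.
        apply: (@le_trans _ _ (\sum_(j < n) (m.1%:R + m.1%:R ^+ 2 / 2))).
          by apply: ler_sum => j _; exact: nc.
        by rewrite sumr_const card_ord mulr_natl.
      have : m.1%:R <= m.1%:R ^+ 2 :> R.
        by rewrite -natrX ler_nat; case: (nat_of_ord m.1) => // k; rewrite leq_pmulr.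
      lra.
    rewrite expRM_natl lerXn2r ?nnegrE ?expR_ge0//.
    have := expR_ge1Dx (1 / 2 : R); rewrite expRN => h.
    have -> : 2 / 3 = (3 / 2)^-1 :> R by field.
    by rewrite lef_pV2 ?posrE ?expR_gt0//; lra.
  rewrite -(pair_bigA _ (fun (k : 'I_n.+1) (_ : bool) => (2 / 3) ^+ k)) /=.
  under eq_bigr do rewrite sumr_const card_bool.
  have g0 : 0 <= 2 / 3 :> R by lra.
  have g1 : 2 / 3 < 1 :> R by lra.
  have g2 : (1 - 2 / 3)^-1 = 3 :> R by field.
  have := geometric_le n.+1 g0 g1; rewrite g2 sumrMnl -[X in _ -> X <= _]mulr_natr; lra.
apply: (@le_trans _ _ (\sum_(x : {ffun 'I_n -> option bool}) (6 ^+ n)%:E)%E).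
  by apply: lee_sum => x _; exact: row6.
rewrite sumEFin lee_fin sumr_const card_ffun card_option card_bool card_ord.
rewrite -[leLHS]mulr_natr natrX -exprMn expRM_natr lerXn2r ?nnegrE ?expR_ge0// ?mulr_ge0//.
have -> : 5 = 5%:R * 1 :> R by rewrite mulr1.
rewrite expRM_natl; apply: (@le_trans _ _ (2 ^+ 5)); first by lra.
by rewrite lerXn2r ?nnegrE ?expR_ge0// (expR1_ge2 R).
Qed.

End functionals.

(** * Operator norms and zeroed blocks *)

Lemma eucl_normE (R : realType) (n : nat) (x : 'cV[R]_n) :
  eucl_norm x = Num.sqrt (sqnorm (fun i => x i 0)).
Proof. by []. Qed.

Lemma op_norm_le (R : realType) (n : nat) (B : 'M[R]_n) (D : R) :
  (0 < n)%N -> 0 <= D -> (forall x, sqnorm (matvec (fun i j => B i j) x) <= D * sqnorm x) ->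
  op_norm B <= Num.sqrt D.
Proof.
move=> n0 D0 hB; apply: ge_sup.
  (* The set under the supremum must be nonempty; the all-ones vector is nonzero because [n > 0]. *)
  exists (eucl_norm (B *m const_mx 1) / eucl_norm (const_mx 1 : 'cV[R]_n)).
  exists (const_mx 1) => //=; apply/eqP => /matrixP/(_ (Ordinal n0) 0).
  by rewrite !mxE => /eqP; rewrite oner_eq0.
move=> _ [x /= x0 <-]; rewrite !eucl_normE.
have s0 : 0 < sqnorm (fun i => x i 0).
  rewrite lt_neqAle sqnorm_ge0 andbT eq_sym; apply/negP => /eqP s0; move/eqP: x0; apply.
  apply/matrixP => i j; rewrite mxE ord1; apply/eqP.
  by rewrite -sqrf_eq0 eq_le sqr_ge0 andbT -s0 (sqnorm_coord (fun i => x i 0)).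
rewrite ler_pdivrMr ?sqrtr_gt0// -sqrtrM// ler_sqrt ?mulr_ge0 ?sqnorm_ge0//.
apply: le_trans (hB (fun i => x i 0)); rewrite le_eqVlt; apply/orP; left; apply/eqP.
by apply: eq_bigr => i _; rewrite mxE.
Qed.

(** Split [x] into [y] off [J] and [z] on [J]. The bound for [y] is given; [z] only meets rows off
    [I], and its image [v] satisfies [|v|^2 = <z, B^T v>], so the transposed bound applied to [v]
    controls it. *)
Lemma zero_block_le (R : realType) (n : nat) (B : 'M[R]_n) (I J : {set 'I_n}) (D : R) : 0 <= D ->
  (forall x, (forall j, j \in J -> x j = 0) ->
    sqnorm (matvec (fun i j => B i j) x) <= D * sqnorm x) ->
  (forall x, (forall i, i \in I -> x i = 0) ->
    sqnorm (matvec (fun j i => B i j) x) <= D * sqnorm x) ->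
  forall x, sqnorm (matvec (fun i j => zero_block B I J i j) x) <= 2 * D * sqnorm x.
Proof.
move=> D0 hJ hI x.
pose y j := if j \in J then 0 else x j.
pose z j := if j \in J then x j else 0.
pose v i := if i \in I then 0 else matvec (fun i j => B i j) z i.
have -> : sqnorm (matvec (fun i j => zero_block B I J i j) x) =
    sqnorm (fun i => matvec (fun i j => B i j) y i + v i).
  apply: eq_bigr => i _; congr (_ ^+ 2); rewrite /v /matvec; case: ifPn => iI.
    rewrite addr0; apply: eq_bigr => j _; rewrite mxE iI /= /y.
    by case: ifP => _; rewrite ?mul0r ?mulr0.
  rewrite -big_split; apply: eq_bigr => j _; rewrite mxE (negbTE iI) /= /y /z.
  by case: ifP => _; rewrite mulr0 ?addr0 ?add0r.
have hz : sqnorm v <= D * sqnorm z.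
  have e : sqnorm v = \sum_j z j * matvec (fun j i => B i j) v j.
    transitivity (\sum_i \sum_j v i * (B i j * z j)).
      apply: eq_bigr => i _; rewrite -big_distrr /= expr2 {2}/v.
      by rewrite /v; case: ifP => _; rewrite ?mul0r.
    rewrite exchange_big; apply: eq_bigr => j _; rewrite /matvec big_distrr /=.
    by apply: eq_bigr => i _; ring.
  have h1 : sqnorm v ^+ 2 <= sqnorm z * (D * sqnorm v).
    rewrite {1}e; apply: (le_trans (cauchy_schwarz_sum _ _)).
    by rewrite ler_wpM2l ?sqnorm_ge0// hI// => i iI; rewrite /v iI.
  have [v0|v0] := eqVneq (sqnorm v) 0.
    by rewrite v0 mulr_ge0// sqnorm_ge0.
  have vp : 0 < sqnorm v by rewrite lt_neqAle sqnorm_ge0 eq_sym v0.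
  by rewrite -(ler_pM2r vp) -expr2 (le_trans h1)// le_eqVlt; apply/orP; left; apply/eqP; ring.
apply: (le_trans (sqnormD_le _ _)).
have hy : sqnorm (matvec (fun i j => B i j) y) <= D * sqnorm y.
  by apply: hJ => j jJ; rewrite /y jJ.
have e : sqnorm x = sqnorm y + sqnorm z.
  rewrite /sqnorm -big_split; apply: eq_bigr => j _; rewrite /y /z /=.
  by case: ifP => _; rewrite expr0n ?addr0 ?add0r.
rewrite e; move: hy hz; move: (sqnorm (matvec _ y)) (sqnorm v) (sqnorm y) (sqnorm z) => a b c f h1 h2.
by rewrite -[2 * D * _]mulrA mulrDr mulrDr lerD// ler_pM2l.
Qed.

Lemma sqrt_bound (R : realType) (n : nat) (L l eps k : R) :
  0 < eps -> 0 <= l -> 0 <= L -> L <= 70 * l -> 0 <= k ->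
  Num.sqrt (2 * ((k * L) ^+ 2 * (n%:R / eps))) <=
  2 * k * 70 * l / Num.sqrt eps * Num.sqrt n%:R.
Proof.
move=> e0 l0 L0 Ll k0; have q0 : 0 < Num.sqrt eps by rewrite sqrtr_gt0.
have c0 : 0 <= 2 * k * 70 * l by rewrite !mulr_ge0.
have -> : 2 * k * 70 * l / Num.sqrt eps * Num.sqrt n%:R =
    Num.sqrt ((2 * k * 70 * l) ^+ 2 * (n%:R / eps)).
  rewrite sqrtrM ?sqr_ge0// sqrtr_sqr ger0_norm// sqrtrM// sqrtrV ?ltW//.
  by rewrite -!mulrA [_^-1 * Num.sqrt _]mulrC.
have h0 : 0 <= n%:R / eps by rewrite divr_ge0// ltW.
apply: ler_wsqrtr; rewrite mulrA; apply: ler_wpM2r => //.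
have h1 : (k * L) ^+ 2 <= (k * (70 * l)) ^+ 2.
  by rewrite lerXn2r ?nnegrE ?mulr_ge0// ler_wpM2l.
have -> : 2 * k * 70 * l = 2 * (k * (70 * l)) by ring.
by have := sqr_ge0 (k * (70 * l)); rewrite [leRHS]exprMn; lra.
Qed.

(** * The random matrix *)

Section failure_events.
Context (d : measure_display) (T : measurableType d) (R : realType).
Context (P : probability T R) (n : nat) (A : 'I_n -> 'I_n -> T -> R) (eps : R).
Hypothesis hA : product_bounded P A.
Hypothesis n0 : (0 < n)%N.
Hypothesis eps0 : 0 < eps.
Hypothesis eps1 : eps <= 1 / 6.

Let L := 69 + ln (eps^-1).
Let p := expR (- (eps * n%:R / 12)).
Let b := eps * n%:R / 4.

Lemma ln_inv_ge1 : 1 <= ln (eps^-1).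
Proof.
rewrite -[1]expRK ler_ln ?posrE ?expR_gt0 ?invr_gt0//.
apply: (le_trans (expR1_le4 R)); rewrite -[4]invrK lef_pV2 ?posrE ?invr_gt0//.
by have := eps1; lra.
Qed.

Lemma row_bound_le : L <= 70 * ln eps^-1.
Proof. by have := ln_inv_ge1; rewrite /L; lra. Qed.

Lemma row_bound_ge1 : 1 <= L.
Proof. by have := ln_inv_ge1; rewrite /L; lra. Qed.

Lemma rowW_event (B : 'I_n -> 'I_n -> T -> R) : product_bounded P B ->
  let S := [set w | expR b < \prod_i rowW L (fun j => B i j w)] in
  measurable S /\ (P S <= p%:E)%E.
Proof.
move=> hB.
have W0 w : 0 <= \prod_i rowW L (fun j => B i j w).
  by apply: prodr_ge0 => i _; exact: le_trans (rowW_ge1 _ _).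
have L64 : 64 <= L by rewrite /L; have := ln_inv_ge1; lra.
have [mS hS] := markov_expR b (measurable_rowW hB L) W0 (expectation_rowW hB n0 L64).
split => //; apply: (le_trans hS); rewrite lee_fin ler_expR.
(* The 69 in [L] is 63 + 6: [exp (63 - L) = eps * exp (- 6)], and the expectation exponent
   [n * eps / 32] falls well below the threshold [b]. *)
have e6 : expR (63 - L) <= eps / 64.
  rewrite /L (_ : 63 - (69 + ln eps^-1) = - 6%:R * 1 + ln eps); last first.
    by rewrite lnV ?posrE//; ring.
  rewrite expRD lnK ?posrE// mulrC ler_pM2l// mulNr expRN expRM_natl.
  rewrite lef_pV2 ?posrE ?exprn_gt0 ?expR_gt0//.
  apply: (@le_trans _ _ (2 ^+ 6)); first lra.
  by rewrite lerXn2r ?nnegrE ?expR_ge0// (expR1_ge2 R).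
have : n%:R * expR (63 - L) <= n%:R * (eps / 64) by rewrite ler_wpM2l.
have : 0 <= eps * n%:R by rewrite mulr_ge0// ltW.
rewrite /b; lra.
Qed.

Lemma hugeH_event :
  let S := [set w | expR b < hugeW (48 * n%:R / eps) (fun i j => A i j w)] in
  measurable S /\ (P S <= p%:E)%E.
Proof.
have N0 : 0 < n%:R :> R by rewrite ltr0n.
have t0 : 0 < 48 * n%:R / eps by rewrite divr_gt0// mulr_gt0.
have H0 w : 0 <= hugeW (48 * n%:R / eps) (fun i j => A i j w).
  by apply: prodr_ge0 => i _; apply: prodr_ge0 => j _; exact: expR_ge0.
have [mS hS] := markov_expR b (measurable_hugeH hA _) H0 (expectation_hugeH hA t0).
split => //; apply: (le_trans hS); rewrite lee_fin ler_expR.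
have -> : 3 / (48 * n%:R / eps) * n%:R ^+ 2 = eps * n%:R / 16.
  by field; rewrite !gt_eqF.
have : 0 <= eps * n%:R by rewrite mulr_ge0// ltW.
rewrite /b; lra.
Qed.

Lemma netV_event (B : 'I_n -> 'I_n -> T -> R) lam : product_bounded P B ->
  0 <= lam -> lam ^+ 2 * (L * n%:R) = 1 ->
  let S := [set w | expR (6 * n%:R) < netV lam (fun i j => B i j w)] in
  measurable S /\ (P S <= p%:E)%E.
Proof.
move=> hB lam0 lamE.
have L1 := row_bound_ge1.
have V0 w : 0 <= netV lam (fun i j => B i j w).
  by apply: sumr_ge0 => x _; apply: prodr_ge0 => i _; exact: netrow_ge0.
have [mS hS] := markov_expR (6 * n%:R) (measurable_netV hB lam) V0
  (expectation_netV hB n0 L1 lam0 lamE).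
split => //; apply: (le_trans hS); rewrite lee_fin ler_expR.
have N0 : 0 <= n%:R :> R by [].
have : eps * n%:R <= 1 * n%:R by rewrite ler_wpM2r//; have := eps1; lra.
lra.
Qed.

Lemma good_event : 12 <= eps * n%:R ->
  exists E : set T, [/\ measurable E,
    forall w, E w -> exists I J : {set 'I_n},
      [/\ #|I|%:R <= eps * n%:R, #|J|%:R <= eps * n%:R &
       op_norm (zero_block (\matrix_(i, j) A i j w) I J) <=
         2 * 120 * 70 * ln (eps^-1) / Num.sqrt eps * Num.sqrt n%:R] &
    ((1 - 7 * p)%:E <= P E)%E].
Proof.
move=> en.
have L1 := row_bound_ge1.
have N0 : 0 < n%:R :> R by rewrite ltr0n.
pose lam := (Num.sqrt (L * n%:R))^-1.
have lam0 : 0 <= lam by rewrite invr_ge0 sqrtr_ge0.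
have Ln0 : 0 < L * n%:R by rewrite mulr_gt0// (lt_le_trans ltr01).
have lamE : lam ^+ 2 * (L * n%:R) = 1.
  by rewrite exprVn sqr_sqrtr ?mulVf ?gt_eqF// ltW.
have hAt := product_bounded_tr hA.
have [m1 p1] := rowW_event hA.
have [m2 p2] := rowW_event hAt.
have [m3 p3] := hugeH_event.
have [m4 p4] := netV_event hA lam0 lamE.
have [m5 p5] := netV_event hAt lam0 lamE.
move: m1 p1 m2 p2 m3 p3 m4 p4 m5 p5.
(* Row weights and sign nets fail separately for the matrix and its transpose; the count of huge
   entries is invariant under transposition. This makes five events of probability at most [p]. *)
set S1 := [set w | _]; set S2 := [set w | _]; set S3 := [set w | _].
set S4 := [set w | _]; set S5 := [set w | _].
move=> m1 p1 m2 p2 m3 p3 m4 p4 m5 p5.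
pose S := S1 `|` S2 `|` S3 `|` S4 `|` S5.
have mS : measurable S by do 4!(apply: measurableU => //).
exists (~` S); split; first exact: measurableC.
- move=> w /not_orP[/not_orP[/not_orP[/not_orP[w1 w2] w3] w4] w5].
  move: w1 w2 w3 w4 w5; rewrite /S1 /S2 /S3 /S4 /S5 /=.
  move=> /negP; rewrite -leNgt => w1 /negP; rewrite -leNgt => w2.
  move=> /negP; rewrite -leNgt => w3 /negP; rewrite -leNgt => w4 /negP; rewrite -leNgt => w5.
  have [J cJ hJ] := @column_removal_bound R n L eps (fun i j => A i j w) n0 L1 eps0 lam en lam0 lamE
    w1 w2 w3 w4.
  have w3' : hugeW (48 * n%:R / eps) (fun j i => A i j w) <= expR b.
    by rewrite /hugeW exchange_big.
  (* For the transpose the two row-weight conditions exchange roles. *)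
  have [I cI hI] := @column_removal_bound R n L eps (fun j i => A i j w) n0 L1 eps0 lam en lam0 lamE
    w2 w1 w3' w5.
  exists I, J; split => //.
  have L0 : 0 <= L by apply: le_trans L1.
  have l1 := ln_inv_ge1.
  have D0 : 0 <= (120 * L) ^+ 2 * (n%:R / eps) by rewrite mulr_ge0 ?sqr_ge0// divr_ge0 ?ltW.
  apply: le_trans (sqrt_bound n eps0 (le_trans ler01 l1) L0 row_bound_le (ler0n R 120)).
  apply: op_norm_le => //; first by rewrite mulr_ge0.
  have mE : (fun i j => (\matrix_(i, j) A i j w) i j) = (fun i j => A i j w).
    by apply/funext => i; apply/funext => j; rewrite mxE.
  have mEt : (fun j i => (\matrix_(i, j) A i j w) i j) = (fun j i => A i j w).
    by apply/funext => j; apply/funext => i; rewrite mxE.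
  by apply: zero_block_le => //; [rewrite mE|rewrite mEt].
- rewrite probability_setC// EFinB leeB//.
  have : (P S <= p%:E + p%:E + p%:E + p%:E + p%:E)%E.
    rewrite /S; do 4!(apply: (le_trans (measureU2 _ _ _)); [by repeat apply: measurableU| by []|apply: leeD => //]).
  move=> /le_trans; apply; rewrite -!EFinD lee_fin.
  have p0 : 0 <= p := expR_ge0 _.
  by move: (p) p0 => q q0; lra.
Qed.

End failure_events.

Theorem mainTheorem1 :
  exists C : rat, 0 < C /\
  forall (R : realType) (n : nat) (d : measure_display) (T : measurableType d)
    (P : probability T R)
    (A : 'I_n -> 'I_n -> T -> R) (eps : R),
    (1 <= n)%N ->
    (forall i j, measurable_fun setT (A i j)) ->
    mutually_independent P (fun k : 'I_n * 'I_n => A k.1 k.2) ->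
    identically_distributed P (fun k : 'I_n * 'I_n => A k.1 k.2) ->
    (forall i j, P.-integrable setT (EFin \o A i j)) ->
    (forall i j, (\int[P]_w (A i j w)%:E = 0)%E) ->
    (forall i j, (\int[P]_w ((A i j w) ^+ 2)%:E = 1)%E) ->
    0 < eps -> eps <= 1 / 6 ->
    exists E : set T, measurable E /\
      (E `<=` [set w | exists I J : {set 'I_n},
          #|I|%:R <= eps * n%:R /\ #|J|%:R <= eps * n%:R /\
          op_norm (zero_block (\matrix_(i, j) A i j w) I J)
            <= ratr C * ln (eps^-1) / Num.sqrt eps * Num.sqrt n%:R]) /\
      ((1 - 7 * expR (- (eps * n%:R / 12)))%:E <= P E)%E.
Proof.
(* 120 comes from the column bound, 70 from [L <= 70 ln (1 / eps)], and 2 covers the factor [sqrt 2]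
   from joining both halves. *)
exists (2 * 120 * 70)%N%:R; split => // R n d T P A eps n0 mA iA _ intA E0 E1 eps0 eps1.
have CE : ratr (2 * 120 * 70)%N%:R = 2 * 120 * 70 :> R by rewrite ratr_nat 2!natrM.
have hA := product_bounded_indep mA iA intA E0 E1.
have [en|en] := leP 12 (eps * n%:R).
  have [E [mE hE pE]] := good_event hA n0 eps0 eps1 en.
  exists E; split => //; split => // w /hE[I [J [cI cJ hIJ]]].
  by exists I, J; split => //; split => //; rewrite CE.
(* If [eps * n < 12], the exponential is at least 1/4, the claimed probability is negative, and the
   empty event suffices. *)
exists set0; split => //; split; first exact: sub0set.
rewrite measure0 lee_fin subr_le0.
have : (4^-1 : R) <= expR (- (eps * n%:R / 12)).
  rewrite expRN lef_pV2 ?posrE ?expR_gt0//.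
  by apply: le_trans (expR1_le4 R); rewrite ler_expR; lra.
lra.
Qed.
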